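(* Let $m,n\ge1$ be integers and let $\pi=(\pi_1,\pi_2,\pi_3)$ be an ordered set partition of $\{1,\dots,m+n-1\}$ with $\#\pi_1=m-1$, $\#\pi_2=1$, $\#\pi_3=n-1$ (where $\pi_1$ or $\pi_3$ may be empty). Then there exists a bijection $$\alpha:\mathsf{stLPP}(\pi)\to\mathsf{Rec}(G_\pi)$$ such that $\mathsf{area}(P)=\mathsf{level}(\alpha(P))$ for all $P\in\mathsf{stLPP}(\pi)$.
   Context: **Polyominoes.** A parallelogram polyomino of size $m\times n$ is a pair of lattice paths from $(0,0)$ to $(m,n)$ with unit north and east steps, such that the first (red) path lies strictly above the second (green) path except at the two endpoints. A labelled parallelogram polyomino is one in which a positive integer is placed in each unit square that has a vertical red step as its left edge and/or a horizontal green step as its bottom edge, so that the labels in each column are strictly increasing from bottom to top and the labels in each row are strictly decreasing from left to right. The label of the bottom-left square (the only square with both kinds of steps) is the black label; the other labels are red or green according to the colour of the path step in their square. $\mathsf{stLPP}(m,n)$ is the set of labelled parallelogram polyominoes of size $m\times n$ whose labels are exactly $1,\dots,m+n-1$, each used once. $\mathsf{stLPP}(\pi)\subseteq\mathsf{stLPP}(m,n)$ is the subset of those whose sets of green, black and red labels are $\pi_1,\pi_2,\pi_3$, respectively. The area of a labelled parallelogram polyomino $P$, $\mathsf{area}(P)$, is the number of unit cells between the two paths that contain no label and such that the label to their left (in the same row) is strictly greater than the label below them (in the same column). **The graph $G_\pi$.** Its vertex set is $\{1,\dots,m+n-1\}$; for $i<j$, $\{i,j\}$ is an edge if and only if either $i\in\pi_1\cup\pi_2$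 and $j\in\pi_3$, or $i\in\pi_1$ and $j\in\pi_2$. Its sink $s$ is the unique element of $\pi_2$. **Sandpile model.** Let $G$ be a finite simple graph with vertex set $V$, edge set $E$ and a distinguished vertex $s$, the sink. A configuration is a map $c:V\to\mathbb{N}=\{0,1,2,\dots\}$. A vertex $i$ is unstable if $c(i)\ge\deg(i)$. A configuration is stable if no vertex other than possibly $s$ is unstable. An unstable vertex $i$ may be toppled, giving the configuration $c'$ with $c'(i)=c(i)-\deg(i)$, $c'(j)=c(j)+1$ for $j$ a neighbour of $i$, and $c'(j)=c(j)$ otherwise; write $c\xrightarrow{i}c'$. A stable configuration $c$ is recurrent if $c(s)=\deg(s)$ and there exists a sequence of vertices $i_1,\dots,i_k$ with $c\xrightarrow{s}c'\xrightarrow{i_1}\cdots\xrightarrow{i_k}c$ (each toppled vertex being unstable when toppled). $\mathsf{Rec}(G)$ is the set of recurrent configurations on $G$, and $\mathsf{level}(c)=\sum_{i\in V}c(i)-\#E$. *)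

(* Defs.v *)
From mathcomp Require Import all_boot all_order all_algebra.
From mathcomp Require Import boolp classical_sets functions.

Set Implicit Arguments.
Unset Strict Implicit.
Unset Printing Implicit Defensive.

(* A lattice path is its list of unit steps: [true] is north, [false] is east. *)
Definition point (p : seq bool) (k : nat) : nat * nat :=
  (count negb (take k p), count id (take k p)).

(* Unit squares of the m x n box: (x, y) stands for [x, x+1] x [y, y+1]. *)
Notation cell m n := ('I_m * 'I_n)%type.

(* Raw data; well-formedness is the predicate [is_lpp]. [None] marks a square
   without a label. *)
Record lpoly (m n : nat) := LPoly {
  red : (m + n).-tuple bool;
  green : (m + n).-tuple bool;
  lab : {ffun cell m n -> option nat}
}.

(* The bounds on k and l are immaterial: [point p k] is the final point of p
   for every k >= size p. *)
Definition strictly_above (m n : nat) (r g : seq bool) : Prop :=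
  forall k l : nat, (point r k).1 = (point g l).1 ->
    (point g l).2 < (point r k).2
    \/ (point r k = point g l /\
        (point g l = (0, 0) \/ point g l = (m, n))).

(* The condition on [count] says that the path ends at (m, n). *)
Definition is_parallelogram (m n : nat) (r g : (m + n).-tuple bool) : Prop :=
  [/\ count id r = n, count id g = n & strictly_above m n r g].

Section LabelledPolyominoes.
Variables (m n : nat) (P : lpoly m n).

Definition red_left (c : cell m n) : bool :=
  [exists k : 'I_(m + n),
    tnth (red P) k && (point (red P) k == (val c.1, val c.2))].

Definition green_bottom (c : cell m n) : bool :=
  [exists k : 'I_(m + n),
    ~~ tnth (green P) k && (point (green P) k == (val c.1, val c.2))].

Definition green_cell (c : cell m n) : bool := green_bottom c && ~~ red_left c.
Definition black_cell (c : cell m n) : bool := green_bottom c && red_left c.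
Definition red_cell (c : cell m n) : bool := red_left c && ~~ green_bottom c.

Definition is_lpp : Prop :=
  [/\ is_parallelogram (red P) (green P),
      forall c, isSome (lab P c) = red_left c || green_bottom c,
      forall c a, lab P c = Some a -> 0 < a,
      forall (x : 'I_m) (y1 y2 : 'I_n) a b, y1 < y2 ->
        lab P (x, y1) = Some a -> lab P (x, y2) = Some b -> a < b
    & forall (x1 x2 : 'I_m) (y : 'I_n) a b, x1 < x2 ->
        lab P (x1, y) = Some a -> lab P (x2, y) = Some b -> b < a].

(* The square lies below the red east step, and above the green east step, of
   its column. *)
Definition between (c : cell m n) : bool :=
  [exists k : 'I_(m + n), [&& ~~ tnth (red P) k,
     (point (red P) k).1 == c.1 & c.2 < (point (red P) k).2]]
  && [exists k : 'I_(m + n), [&& ~~ tnth (green P) k,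
     (point (green P) k).1 == c.1 & (point (green P) k).2 <= c.2]].

(* In a labelled parallelogram polyomino, an unlabelled square between the
   paths has exactly one label to its left in its row (its row's red or black
   label) and exactly one below it in its column (its column's green or black
   label), so the existential picks out these two labels. *)
Definition left_gt_below (c : cell m n) : bool :=
  [exists x : 'I_m, exists y : 'I_n, [&& x < c.1, y < c.2 &
     if (lab P (x, c.2), lab P (c.1, y)) is (Some a, Some b)
     then b < a else false]].

Definition area : nat :=
  #|[pred c : cell m n | [&& between c, lab P c == None & left_gt_below c]]|.

Definition labels_in (D : pred (cell m n)) : seq nat := pmap (lab P) (enum D).

End LabelledPolyominoes.

Definition stLPP (m n : nat) : set (lpoly m n) :=
  fun P => is_lpp P /\ perm_eq (labels_in P predT) (iota 1 (m + n - 1)).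

(* The set {1, ..., N} is represented by 'I_N, the ordinal i standing for the
   integer i + 1. *)
Definition integers_of (N : nat) (A : {set 'I_N}) : seq nat :=
  [seq (val i).+1 | i in A].

Definition ordered_partition (N : nat) (pi1 pi2 pi3 : {set 'I_N}) : Prop :=
  [/\ [disjoint pi1 & pi2], [disjoint pi1 & pi3], [disjoint pi2 & pi3]
    & forall i, i \in pi1 \/ i \in pi2 \/ i \in pi3].

Definition stLPP_of (m n : nat) (pi1 pi2 pi3 : {set 'I_(m + n - 1)}) :
    set (lpoly m n) :=
  fun P => [/\ stLPP P,
    labels_in P (green_cell P) =i integers_of pi1,
    labels_in P (black_cell P) =i integers_of pi2
  & labels_in P (red_cell P) =i integers_of pi3].

Record sgraph (V : finType) := SGraph {
  adj :> rel V;
  adj_sym : symmetric adj;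
  adj_irr : irreflexive adj
}.

Section Sandpile.
Variables (V : finType) (G : sgraph V) (s : V).

Definition deg (i : V) : nat := #|[pred j | G i j]|.

Definition edges : {set {set V}} :=
  [set [set e.1; e.2]%SET | e : V * V & G e.1 e.2]%SET.

Definition config := {ffun V -> nat}.

Definition unstable (c : config) (i : V) : bool := deg i <= c i.

Definition stable (c : config) : Prop := forall i, i != s -> ~~ unstable c i.

(* Meaningful when i is unstable in c; there is no loop, so i is not its own
   neighbour. *)
Definition topple (c : config) (i : V) : config :=
  [ffun j => if j == i then c j - deg i else if G i j then c j + 1 else c j].

Fixpoint topples_to (c : config) (l : seq V) (c' : config) : Prop :=
  if l is i :: l' then unstable c i /\ topples_to (topple c i) l' c'
  else c = c'.

Definition Rec : set config :=
  fun c => [/\ stable c, c s = deg s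
             & exists l : seq V, topples_to c (s :: l) c].

Definition level (c : config) : int :=
  (\sum_(i : V) (c i)%:Z - #|edges|%:Z)%R.

End Sandpile.

Section GraphOfPartition.
Variables (N : nat) (pi1 pi2 pi3 : {set 'I_N}).

Definition edge_lt (i j : 'I_N) : bool :=
  (i < j) && (((i \in pi1 :|: pi2) && (j \in pi3))
              || ((i \in pi1) && (j \in pi2))).

Definition Gadj : rel 'I_N := fun i j => edge_lt i j || edge_lt j i.

Lemma Gadj_sym : symmetric Gadj.
Proof. by move=> i j; rewrite /Gadj orbC. Qed.

Lemma Gadj_irr : irreflexive Gadj.
Proof. by move=> i; rewrite /Gadj /edge_lt ltnn. Qed.

Definition Gpi : sgraph 'I_N := SGraph Gadj_sym Gadj_irr.

End GraphOfPartition.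

(* Main.v *)
Require Import Defs.
From mathcomp Require Import all_boot all_order all_algebra.
From mathcomp Require Import boolp classical_sets functions.
From mathcomp Require Import fintype finset zify.

(** A labelled polyomino is a spanning tree of [Gpi] explored breadth-first.
    Attach every green label to the red or black label of its row, and every
    red label to the green or black label of its column.  The row and column
    conditions say that these pairs are edges of the graph and that the
    children of a vertex are listed in a prescribed order, so the columns from
    left to right and the rows from bottom to top are two queues [X] and [Y],
    both starting with the sink: the green step of column [x] lies at the
    height [h x], the position in [Y] of the parent of [X x], and the red step
    of row [y] has abscissa [k y], the position in [X] of the parent of [Y y].
    That the paths meet only at their endpoints says that [x <= k y] and
    [y <= h x] hold together at the root only ([queue_tree]).

    The bijection gives to a vertex as many grains as it has neighbours
    strictly after its parent in the opposite queue ([tree_config]): when the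
    vertices topple in the order of the queues, each becomes unstable exactly
    when its parent topples.  An edge between column [x] and row [y] adds a
    grain to the column if [h x < y] and a grain to the row if [k y < x].  At
    least one of these holds, so the number of grains exceeds the number of
    edges by the number of edges for which both hold; these are the cells
    counted by the area ([level_tree_config], [tree_area]).

    Recurrence is decided by forbidden subconfigurations
    ([Rec_criterion], [criterion_Rec]): a stable configuration with [deg s]
    grains at the sink [s] of a connected graph is recurrent exactly when every
    nonempty set [U] of other vertices has a vertex with at least as many
    grains as neighbours in [U].  For a queue tree, the first vertex of [U] in
    one of the two queues is such a vertex.

    Conversely, the parent of [v] is the neighbour whose position in the
    opposite queue makes it the neighbour number [deg v - c v] of [v], so [c]
    dictates both queues step by step.  Two trees with the same configuration
    agree on longer and longer initial segments ([queue_tree_inj]); and for a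
    recurrent [c] the criterion, applied to the vertices not yet queued,
    always provides one more vertex ([partial_tree_complete]).

    The two queues play symmetric roles, so most statements are about [X] and
    are applied a second time with [X] and [Y] exchanged. *)

Set Implicit Arguments.
Unset Strict Implicit.
Unset Printing Implicit Defensive.

Import GRing.Theory.

Local Notation point := Defs.point.

(** * Recurrent configurations and forbidden subconfigurations *)

Section Dhar.
Variables (V : finType) (G : sgraph V) (s : V).
Implicit Types (c : config V) (L : seq V) (T U : {set V}).

Definition nbrs_in T v := #|[pred w | (w \in T) && G v w]|.

Lemma deg_split T v : deg G v = nbrs_in T v + nbrs_in (~: T) v.
Proof.
rewrite /deg /nbrs_in -(cardID (mem T)); congr addn; apply: eq_card => w.
- by rewrite !inE andbC.
- by rewrite !inE.
Qed.

Lemma topples_to_count c L c' v : topples_to G c L c' -> v \notin L ->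
  c' v = c v + count (G v) L.
Proof.
elim: L c => [|i L IH] c /=; first by move=> -> _; rewrite addn0.
case=> _ cL; rewrite inE negb_or => /andP[vi vL].
rewrite (IH _ cL vL) ffunE (negPf vi) (adj_sym G i v).
by case: (G v i); rewrite ?add0n ?addn1 ?addSnnS.
Qed.

(** Among the vertices of [U], consider the one whose last toppling comes
    first: the other vertices of [U] topple afterwards, so its neighbours in
    [U] have all sent it a grain which it keeps. *)
Lemma topples_to_subset c L c' U : topples_to G c L c' ->
  {subset U <= L} -> U != set0 -> exists2 v, v \in U & nbrs_in U v <= c' v.
Proof.
elim: L c => [|i L IH] c /=.
  by move=> _ UL /set0Pn[v /UL].
case=> _ cL UL U0.
have [sUL|] := boolP [forall v in U, v \in L].
  apply: (IH _ cL _ U0) => v vU.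
  by move/forallP: sUL => /(_ v); rewrite vU.
case/forallPn=> v; rewrite negb_imply => /andP[vU vL].
have vi : v = i by move: (UL v vU); rewrite inE (negPf vL) orbF => /eqP.
exists v => //; rewrite (topples_to_count cL vL) -size_filter.
apply: leq_trans (leq_addl _ _); apply: leq_trans (card_size _).
apply: subset_leq_card; apply/fintype.subsetP => w; rewrite !inE mem_filter.
case/andP=> wU vw; rewrite vw; move: (UL w wU); rewrite inE.
case/orP=> // /eqP wi; by move: vw; rewrite wi vi (adj_irr G).
Qed.

(** A toppling sequence that returns to [c] brings no grain to a vertex that
    does not topple, so the set of toppled vertices is closed under adjacency;
    it contains the sink, hence everything. *)
Lemma Rec_criterion c U : (forall v, connect G s v) -> Rec G s c ->
  U != set0 -> exists2 v, v \in U & nbrs_in U v <= c v.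
Proof.
move=> cG [_ _ [l cl]] U0; apply: (topples_to_subset cl _ U0) => v _.
suff /closed_connect/(_ _ _ (cG v)) <- : closed G (mem (s :: l)) by rewrite inE eqxx.
apply: intro_closed => [|x y xy]; first exact: sym_connect_sym (adj_sym G).
apply: contraLR => ynl; have := topples_to_count cl ynl.
rewrite -[LHS]addn0 => /addnI/esym/eqP; rewrite -leqn0 leqNgt -has_count.
by apply: contraNN => xl; apply/hasP; exists x; rewrite ?(adj_sym G y x).
Qed.

(** The configuration reached from [c] once the vertices of [T] have toppled
    once each, in any legal order. *)
Definition toppled c T : config V :=
  [ffun v => c v + nbrs_in T v - (if v \in T then deg G v else 0)].

Lemma nbrs_in_setU1 T v w : w \notin T ->
  nbrs_in (w |: T) v = nbrs_in T v + G v w.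
Proof.
move=> wT; rewrite /nbrs_in [in LHS](cardD1 w) !inE eqxx /= addnC; congr addn.
apply: eq_card => u; rewrite !inE; case: eqP => // ->.
by rewrite (negPf wT).
Qed.

Lemma topple_toppled c T v : v \notin T ->
  (forall w, w \in T -> deg G w <= c w + nbrs_in T w) ->
  topple G (toppled c T) v = toppled c (v |: T).
Proof.
move=> vT legal; apply/ffunP => w; rewrite !ffunE in_setU1 nbrs_in_setU1 //.
have [->|wv] := eqVneq; first by rewrite (negPf vT) (adj_irr G) subn0 addn0.
rewrite (adj_sym G v w) /=; case: ifP => vw; last by rewrite addn0.
by case: ifP => wT; rewrite ?subn0 ?addnA // addnBAC ?legal.
Qed.

(** Toppling each vertex once leads back to [c].  As long as some vertices
    have not toppled, the hypothesis applied to the set they form gives one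
    that is unstable. *)
Lemma criterion_Rec c : stable G s c -> c s = deg G s ->
  (forall U, s \notin U -> U != set0 ->
     exists2 v, v \in U & nbrs_in U v <= c v) ->
  Rec G s c.
Proof.
move=> stc cs crit; split=> //.
suff run T : s \in T -> (forall w, w \in T -> deg G w <= c w + nbrs_in T w) ->
    exists l, topples_to G (toppled c T) l c.
  have c0 : toppled c set0 = c.
    apply/ffunP => v; rewrite ffunE inE subn0 /nbrs_in.
    by rewrite [X in _ + X]eq_card0 ?addn0 // => w; rewrite !inE.
  have [|w /set1P->|l ls] := run [set s]%SET; rewrite ?set11 ?cs ?leq_addr //.
  exists l; split; first by rewrite /unstable cs.
  by rewrite -[X in topple _ X]c0 topple_toppled ?inE ?setU0 // => w; rewrite inE.
have [k] := ubnP #|~: T|; elim: k T => // k IH T Tk sT legal.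
have [Tfull|TC0] := eqVneq (~: T)%SET set0.
  suff -> : toppled c T = c by exists [::].
  apply/ffunP => v; rewrite ffunE (deg_split T) Tfull.
  have -> : v \in T by rewrite -[T]setCK Tfull !inE.
  have -> : nbrs_in set0 v = 0 by apply: eq_card0 => w; rewrite !inE.
  by rewrite addn0 addnK.
have [|v vT vc] := crit _ _ TC0; first by rewrite inE sT.
have vT' : v \notin T by move: vT; rewrite inE.
have vdeg : deg G v <= c v + nbrs_in T v.
  by rewrite (deg_split T) addnC leq_add2r.
have [||w|l tl] := IH (v |: T)%SET.
- suff <- : #|~: T| = #|~: (v |: T)|.+1 by [].
  rewrite (cardsD1 v) vT add1n; congr _.+1; apply: eq_card => u.
  by rewrite !inE negb_or.
- by rewrite inE sT orbT.
- rewrite in_setU1 nbrs_in_setU1 // addnA => /orP[/eqP->|/legal H].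
    exact: leq_trans vdeg (leq_addr _ _).
  exact: leq_trans H (leq_addr _ _).
exists (v :: l) => /=; rewrite topple_toppled //; split=> //.
by rewrite /unstable ffunE (negPf vT') subn0.
Qed.

End Dhar.

(** * Trees explored with two queues *)

Section QueueTrees.
Variables (V : finType) (G : sgraph V) (s : V).

(** Removing [s] leaves a bipartite graph; [s] may have neighbours on both
    sides. *)
Record bipartite_off (S T : {set V}) : Prop := BipartiteOff {
  off_rootS : s \notin S;
  off_rootT : s \notin T;
  off_disj : forall v, v \in S -> v \notin T;
  off_cover : forall v, [|| v == s, v \in S | v \in T];
  off_nbrS : forall v w, v \in S -> G v w -> w \in s |: T;
  off_nbrT : forall v w, v \in T -> G v w -> w \in s |: S
}.

Lemma bipartite_off_sym S T : bipartite_off S T -> bipartite_off T S.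
Proof.
case=> sS sT ST cov aS aT; split=> // [v vT|v].
  by apply: contraL vT => /ST.
by rewrite [X in _ || X]orbC.
Qed.

(** [X] lists [S] after the root, and [h x] is the position in the opposite
    queue [Y] of the parent of [X x].  Vertices enter [X] in the order of their
    parents, and siblings in the order [ord]. *)
Record queue (p q : nat) (S : {set V}) (ord : V -> nat)
    (X : 'I_p -> V) (Y : 'I_q -> V) (h : 'I_p -> 'I_q) : Prop := Queue {
  queue_inj : injective X;
  queue_onto : forall v, v \in s |: S -> exists x, X x = v;
  queue_root : forall x : 'I_p, x = 0 :> nat -> X x = s;
  queue_in : forall x : 'I_p, 0 < x -> X x \in S;
  queue_adj : forall x : 'I_p, 0 < x -> G (X x) (Y (h x));
  queue_ord : forall x x' : 'I_p, 0 < x -> x < x' ->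
    h x < h x' \/ (h x = h x' /\ ord (X x) < ord (X x'))
}.

Record queue_tree (p q : nat) (S T : {set V}) (ordS ordT : V -> nat)
    (X : 'I_p -> V) (Y : 'I_q -> V) (h : 'I_p -> 'I_q) (k : 'I_q -> 'I_p) :
    Prop := QueueTree {
  treeX : queue S ordS X Y h;
  treeY : queue T ordT Y X k;
  tree_noncrossing : forall (x : 'I_p) (y : 'I_q), x <= k y -> y <= h x ->
    x = 0 :> nat /\ y = 0 :> nat
}.

Lemma queue_tree_sym p q S T ordS ordT (X : 'I_p -> V) (Y : 'I_q -> V) h k :
  queue_tree S T ordS ordT X Y h k -> queue_tree T S ordT ordS Y X k h.
Proof.
case=> qX qY nc; split=> // y x yh xk.
by have [-> ->] := nc _ _ xk yh.
Qed.

(** Each of the two sums has at most one term: the position of [v] in the queue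
    that contains it.  The sink is in both queues. *)
Definition tree_config p q (X : 'I_p -> V) (Y : 'I_q -> V)
    (h : 'I_p -> 'I_q) (k : 'I_q -> 'I_p) : config V :=
  [ffun v => \sum_(x | X x == v) #|[pred y : 'I_q | (h x < y) && G v (Y y)]|
           + \sum_(y | Y y == v) #|[pred x : 'I_p | (k y < x) && G v (X x)]|].

Lemma tree_config_sym p q (X : 'I_p -> V) (Y : 'I_q -> V) h k :
  tree_config Y X k h = tree_config X Y h k.
Proof. by apply/ffunP => v; rewrite !ffunE addnC. Qed.

Section OneTree.
Variables (p q : nat) (S T : {set V}) (ordS ordT : V -> nat).
Variables (X : 'I_p -> V) (Y : 'I_q -> V) (h : 'I_p -> 'I_q) (k : 'I_q -> 'I_p).
Hypothesis ST : bipartite_off S T.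
Hypothesis XY : queue_tree S T ordS ordT X Y h k.

Let qX := treeX XY.
Let qY := treeY XY.

(** The root is its own parent: for [x = 0] and any other value of [h x], the
    cell [(x, h x)] would be a crossing. *)
Lemma tree_parent0 (x : 'I_p) : x = 0 :> nat -> h x = 0 :> nat.
Proof.
move=> x0; have xk : x <= k (h x) by rewrite x0.
by have [_ ->] := tree_noncrossing XY xk (leqnn _).
Qed.

Lemma queue_eq_root x : (X x == s) = (x == 0 :> nat).
Proof.
apply/eqP/eqP => [Xs|/(queue_root qX) //]; apply/eqP; rewrite -leqn0 leqNgt.
by apply: contraL (off_rootS ST) => /(queue_in qX); rewrite Xs negbK.
Qed.

Lemma queue_neq (x : 'I_p) y : 0 < x -> Y y != X x.
Proof.
move=> x0; have XS := queue_in qX x0; apply/eqP => YX.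
have [y0|y0] := posnP y.
  by move: (off_rootS ST); rewrite -(queue_root qY y0) YX XS.
by move: (queue_in qY y0); rewrite YX (negPf (off_disj ST XS)).
Qed.

(** All the neighbours of a vertex of [S] are listed, once each, by [Y]. *)
Lemma card_nbrs v (A : pred V) : v \in S ->
  #|[pred w | A w && G v w]| = #|[pred y | A (Y y) && G v (Y y)]|.
Proof.
move=> vS; rewrite -(card_image (queue_inj qY)); apply: eq_card => w.
rewrite !inE; apply/andP/imageP => [[Aw vw]|[y]]; last by rewrite inE => /andP[? ?] ->.
by have [y Yy] := queue_onto qY (off_nbrS ST vS vw); exists y; rewrite // inE Yy Aw.
Qed.

Lemma deg_queue (x : 'I_p) : 0 < x -> deg G (X x) = #|[pred y | G (X x) (Y y)]|.
Proof.
by move=> x0; rewrite /deg (card_nbrs predT (queue_in qX x0)).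
Qed.

Lemma tree_config_queue (x : 'I_p) : 0 < x ->
  tree_config X Y h k (X x) = #|[pred y : 'I_q | (h x < y) && G (X x) (Y y)]|.
Proof.
move=> x0; rewrite ffunE [X in _ + X]big_pred0 => [|y].
  by rewrite addn0 (big_pred1 x) // => x'; rewrite (inj_eq (queue_inj qX)).
exact: negbTE (queue_neq y x0).
Qed.

Lemma tree_config_queue_deg (x : 'I_p) : 0 < x ->
  deg G (X x) = #|[pred y : 'I_q | (y <= h x) && G (X x) (Y y)]|
    + tree_config X Y h k (X x).
Proof.
move=> x0; rewrite tree_config_queue // deg_queue //.
rewrite -(cardID [pred y : 'I_q | y <= h x]); congr addn; apply: eq_card => y.
- by rewrite !inE andbC.
- by rewrite !inE -ltnNge.
Qed.

Lemma tree_config_lt (x : 'I_p) : 0 < x -> tree_config X Y h k (X x) < deg G (X x).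
Proof.
move=> x0; rewrite tree_config_queue_deg // -addn1 addnC leq_add2r.
by apply/card_gt0P; exists (h x); rewrite inE leqnn (queue_adj qX).
Qed.

Lemma tree_config_queue_nbrs (x : 'I_p) (U : {set V}) : 0 < x ->
  (forall y : 'I_q, Y y \in U -> h x < y) ->
  nbrs_in G U (X x) <= tree_config X Y h k (X x).
Proof.
move=> x0 Uh; rewrite tree_config_queue // /nbrs_in.
rewrite (card_nbrs (mem U) (queue_in qX x0)).
apply: subset_leq_card; apply/fintype.subsetP => y; rewrite !inE.
by case/andP=> /Uh -> ->.
Qed.

End OneTree.

Section RecurrentTree.
Variables (p q : nat) (S T : {set V}) (ordS ordT : V -> nat).
Variables (X : 'I_p -> V) (Y : 'I_q -> V) (h : 'I_p -> 'I_q) (k : 'I_q -> 'I_p).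
Hypotheses (p0 : 0 < p) (q0 : 0 < q).
Hypothesis ST : bipartite_off S T.
Hypothesis XY : queue_tree S T ordS ordT X Y h k.

Let TS := bipartite_off_sym ST.
Let YX := queue_tree_sym XY.
Let qX := treeX XY.
Let qY := treeY XY.

Lemma tree_vertex v : v != s ->
  (exists2 x : 'I_p, 0 < x & X x = v) \/ (exists2 y : 'I_q, 0 < y & Y y = v).
Proof.
move=> vs; move: (off_cover ST v); rewrite (negPf vs) /=; case/orP => vS.
- have [x Xv] : exists x, X x = v by apply: (queue_onto qX); rewrite inE vS orbT.
  by left; exists x; rewrite // lt0n -(queue_eq_root ST XY) Xv.
- have [y Yv] : exists y, Y y = v by apply: (queue_onto qY); rewrite inE vS orbT.
  by right; exists y; rewrite // lt0n -(queue_eq_root TS YX) Yv.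
Qed.

Lemma deg_root : deg G s = #|[pred y | G s (Y y)]| + #|[pred x | G s (X x)]|.
Proof.
rewrite -(card_image (queue_inj qX)) -(card_image (queue_inj qY)) -cardUI.
rewrite [X in _ + X]eq_card0 ?addn0.
  apply: eq_card => w; rewrite !inE; apply/idP/orP => [sw|[]/imageP[? + ->]] //.
  have ws : w != s by apply: contraL sw => /eqP->; rewrite (adj_irr G).
  have [[x _ Xw]|[y _ Yw]] := tree_vertex ws.
    by right; apply/imageP; exists x; rewrite // inE Xw.
  by left; apply/imageP; exists y; rewrite // inE Yw.
move=> w; rewrite !inE; apply/negP => /andP[/imageP[y _ ->] /imageP[x]].
rewrite inE => sx; apply/eqP/(queue_neq ST XY); rewrite lt0n -(queue_eq_root ST XY).
by apply: contraL sx => /eqP->; rewrite (adj_irr G).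
Qed.

Lemma tree_config_root : tree_config X Y h k s = deg G s.
Proof.
pose x0 := Ordinal p0; pose y0 := Ordinal q0.
rewrite ffunE (big_pred1 x0) => [|x]; last by rewrite (queue_eq_root ST XY).
rewrite (big_pred1 y0) => [|y]; last by rewrite (queue_eq_root TS YX).
rewrite deg_root; congr addn; apply: eq_card => z; rewrite !inE.
  rewrite (tree_parent0 XY) //; apply: andb_idl; rewrite lt0n -(queue_eq_root TS YX).
  by apply: contraL => /eqP->; rewrite (adj_irr G).
rewrite (tree_parent0 YX) //; apply: andb_idl; rewrite lt0n -(queue_eq_root ST XY).
by apply: contraL => /eqP->; rewrite (adj_irr G).
Qed.

Lemma min_position r (Z : 'I_r -> V) (U : {set V}) :
  (forall z, Z z \notin U) \/
  exists2 z : 'I_r, Z z \in U & forall z' : 'I_r, Z z' \in U -> z <= z'.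
Proof.
have [[z0 Uz0]|noU] := pselect (exists z, Z z \in U); last first.
  by left=> z; apply/negP => Uz; apply: noU; exists z.
by right; case: (@arg_minnP _ z0 (fun z => Z z \in U) val) => // z; exists z.
Qed.

(** If [a] and [b] are the first positions of [U] in the two queues, then by
    noncrossing the parent of one of [X a], [Y b] comes before [U] in the
    opposite queue; that vertex holds a grain for each neighbour in [U]. *)
Lemma tree_config_criterion (U : {set V}) : s \notin U -> U != set0 ->
  exists2 v, v \in U & nbrs_in G U v <= tree_config X Y h k v.
Proof.
move=> sU /set0Pn[u uU].
have posX (x : 'I_p) : X x \in U -> 0 < x.
  by move=> xU; rewrite lt0n -(queue_eq_root ST XY); apply: contraNneq sU => <-.
have posY (y : 'I_q) : Y y \in U -> 0 < y.
  by move=> yU; rewrite lt0n -(queue_eq_root TS YX); apply: contraNneq sU => <-.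
have [noX|[a aU amin]] := min_position X U; have [noY|[b bU bmin]] := min_position Y U.
- have us : u != s by apply: contraTneq uU => ->.
  have [[x _ ux]|[y _ uy]] := tree_vertex us.
    by move: (noX x); rewrite ux uU.
  by move: (noY y); rewrite uy uU.
- exists (Y b); rewrite // -tree_config_sym.
  apply: (tree_config_queue_nbrs TS YX (posY _ bU)) => x xU.
  by move: (noX x); rewrite xU.
- exists (X a); rewrite //.
  apply: (tree_config_queue_nbrs ST XY (posX _ aU)) => y yU.
  by move: (noY y); rewrite yU.
have [ha|bh] := ltnP (h a) b.
  exists (X a); rewrite //.
  apply: (tree_config_queue_nbrs ST XY (posX _ aU)) => y /bmin; exact: leq_trans.
have kb : k b < a.
  rewrite ltnNge; apply/negP => ak; have [a0 _] := tree_noncrossing XY ak bh.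
  by move: (posX _ aU); rewrite a0.
exists (Y b); rewrite // -tree_config_sym.
apply: (tree_config_queue_nbrs TS YX (posY _ bU)) => x /amin; exact: leq_trans.
Qed.

Lemma tree_config_Rec : Rec G s (tree_config X Y h k).
Proof.
apply: criterion_Rec tree_config_root tree_config_criterion => v.
rewrite /unstable -ltnNge => /tree_vertex[][z z0 <-].
  exact: tree_config_lt ST XY _ z0.
by rewrite -tree_config_sym; exact: tree_config_lt TS YX _ z0.
Qed.

Lemma sum_fibre (I : finType) (f : I -> V) (F : I -> V -> nat) :
  \sum_v \sum_(i | f i == v) F i v = \sum_i F i (f i).
Proof.
rewrite (exchange_big_dep xpredT) //=; apply: eq_bigr => i _.
by rewrite (big_pred1 (f i)) // => v; rewrite eq_sym.
Qed.

Lemma sum_tree_config : \sum_v tree_config X Y h k v =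
  #|[pred c : 'I_p * 'I_q | (h c.1 < c.2) && G (X c.1) (Y c.2)]| +
  #|[pred c : 'I_p * 'I_q | (k c.2 < c.1) && G (X c.1) (Y c.2)]|.
Proof.
under eq_bigr do rewrite ffunE.
rewrite big_split /= !sum_fibre; congr addn.
  by under eq_bigr do rewrite -sum1_card; rewrite pair_big_dep /= sum1_card.
under eq_bigr do rewrite -sum1_card.
rewrite (exchange_big_dep xpredT) //= pair_big_dep /= sum1_card.
by apply: eq_card => -[x y]; rewrite /in_mem /= (adj_sym G (Y y)).
Qed.

(** An edge determines its cell: a vertex other than the root lies in only one
    of the queues. *)
Lemma card_edges : #|edges G| = #|[pred c : 'I_p * 'I_q | G (X c.1) (Y c.2)]|.
Proof.
have XYs x y : X x = Y y -> X x = s.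
  move=> XYxy; apply/eqP; rewrite (queue_eq_root ST XY) -leqn0 leqNgt.
  by apply/negP => /(queue_neq ST XY y); rewrite XYxy eqxx.
rewrite -(card_in_image (f := fun c => [set X c.1; Y c.2])); last first.
  move=> [x y] [x' y']; rewrite !inE /= => xy xy' e.
  have /set2P[Xx|Xx] : X x \in [set X x'; Y y'] by rewrite -e set21.
    have /set2P[Yy|Yy] : Y y \in [set X x'; Y y'] by rewrite -e set22.
      by move: xy; rewrite Yy Xx (adj_irr G).
    by rewrite (queue_inj qX Xx) (queue_inj qY Yy).
  have /set2P[Yy|Yy] : Y y \in [set X x'; Y y'] by rewrite -e set22.
    by move: xy; rewrite (XYs _ _ Xx) Yy (XYs _ _ (esym Yy)) (adj_irr G).
  by move: xy; rewrite Xx Yy (adj_irr G).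
have edgeXY v w : G v w -> exists x y, [set v; w] = [set X x; Y y] /\ G (X x) (Y y).
  move=> vw; have [vs|vs] := eqVneq v s.
    have ws : w != s by apply: contraTneq vw => ->; rewrite vs (adj_irr G).
    have [[x _ Xw]|[y _ Yw]] := tree_vertex ws.
      exists x, (Ordinal q0); rewrite (queue_root qY) // Xw -vs.
      by rewrite setUC (adj_sym G).
    by exists (Ordinal p0), y; rewrite (queue_root qX) // Yw -vs.
  have [[x x0 Xv]|[y y0 Yv]] := tree_vertex vs; subst v.
    have [y Yw] := queue_onto qY (off_nbrS ST (queue_in qX x0) vw).
    by exists x, y; rewrite Yw.
  have [x Xw] := queue_onto qX (off_nbrS TS (queue_in qY y0) vw).
  by exists x, y; rewrite Xw setUC (adj_sym G).
apply: eq_card => e; apply/imsetP/imageP => [[[v w] + ->]|[[x y] + ->]].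
  rewrite inE /= => /edgeXY[x [y [-> xy]]]; by exists (x, y).
by rewrite inE /= => xy; exists (X x, Y y); rewrite ?inE.
Qed.

(** Inclusion-exclusion on the cells [(x, y)] that are edges: noncrossing makes
    them the union of those with [h x < y] and those with [k y < x]. *)
Lemma level_tree_config : level G (tree_config X Y h k) =
  Posz #|[pred c : 'I_p * 'I_q | [&& k c.2 < c.1, h c.1 < c.2 & G (X c.1) (Y c.2)]]|.
Proof.
rewrite /level -(big_morph Posz PoszD (erefl _)) sum_tree_config card_edges -cardUI.
rewrite [X in X + _](_ : _ = #|[pred c : 'I_p * 'I_q | G (X c.1) (Y c.2)]|).
  rewrite PoszD addrC addKr; congr Posz; apply: eq_card => c; rewrite !inE.
  by case: (G _ _); rewrite ?andbF // !andbT andbC.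
apply: eq_card => -[x y]; rewrite !inE /= -andb_orl; apply: andb_idl => xy.
rewrite !ltnNge -negb_and; apply/negP => /andP[yh xk].
have [x0 y0] := tree_noncrossing XY xk yh.
by move: xy; rewrite (queue_root qX) // (queue_root qY) // (adj_irr G).
Qed.

End RecurrentTree.
End QueueTrees.

(** * A queue tree is determined by its configuration *)

Section Injectivity.
Variables (V : finType) (G : sgraph V) (s : V).

Lemma card_upto_lt q (P : pred 'I_q) (j j' : 'I_q) : j < j' -> P j' ->
  #|[pred y : 'I_q | (y <= j) && P y]| < #|[pred y : 'I_q | (y <= j') && P y]|.
Proof.
move=> jj' Pj'; apply: proper_card; rewrite properE; apply/andP; split.
  by apply/fintype.subsetP => y; rewrite !inE => /andP[yj ->]; rewrite andbT; lia.
by apply/subsetPn; exists j'; rewrite !inE ?leqnn ?Pj' // andbT -ltnNge.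
Qed.

Section SameParent.
Variables (p q : nat) (S T : {set V}) (ordS ordT : V -> nat).
Variables (X X' : 'I_p -> V) (Y Y' : 'I_q -> V).
Variables (h h' : 'I_p -> 'I_q) (k k' : 'I_q -> 'I_p).
Hypothesis ST : bipartite_off G s S T.
Hypothesis XY : queue_tree G s S T ordS ordT X Y h k.
Hypothesis XY' : queue_tree G s S T ordS ordT X' Y' h' k'.
Hypothesis cc' : tree_config G X Y h k = tree_config G X' Y' h' k'.

(** [deg v - c v] counts the neighbours of [v] up to and including its parent,
    so it locates the parent as soon as the opposite queues agree up to there. *)
Lemma same_parent (x x' : 'I_p) (b : nat) : 0 < x -> 0 < x' -> X x = X' x' ->
  (forall y : 'I_q, y < b -> Y y = Y' y) -> h x < b -> h x = h' x'.
Proof.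
move=> x0 x0' xx' agree hb.
have := tree_config_queue_deg ST XY' x0'; rewrite -cc' -xx'.
rewrite (tree_config_queue_deg ST XY x0) => /addIn count_eq.
have adj := queue_adj (treeX XY) x0; have adj' := queue_adj (treeX XY') x0'.
rewrite -xx' in adj'.
have agree_card j : j < b -> #|[pred y : 'I_q | (y <= j) && G (X x) (Y y)]| =
    #|[pred y : 'I_q | (y <= j) && G (X x) (Y' y)]|.
  move=> jb; apply: eq_card => y; rewrite !inE; case: leqP => //= yj.
  by rewrite agree //; exact: leq_ltn_trans jb.
apply: val_inj => /=; case: (ltngtP (h x) (h' x')) => // lt.
  have := card_upto_lt (P := fun y => G (X x) (Y' y)) lt adj'.
  by rewrite -count_eq -agree_card ?ltnn.
have := card_upto_lt (P := fun y => G (X x) (Y y)) lt adj.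
by rewrite count_eq agree_card ?ltnn //; exact: ltn_trans hb.
Qed.

End SameParent.

Section NextVertex.
Variables (p q : nat) (S T : {set V}) (ordS ordT : V -> nat).
Variables (X X' : 'I_p -> V) (Y Y' : 'I_q -> V).
Variables (h h' : 'I_p -> 'I_q) (k k' : 'I_q -> 'I_p).
Hypothesis ST : bipartite_off G s S T.
Hypothesis XY : queue_tree G s S T ordS ordT X Y h k.
Hypothesis XY' : queue_tree G s S T ordS ordT X' Y' h' k'.
Hypothesis cc' : tree_config G X Y h k = tree_config G X' Y' h' k'.

(** The vertices at position [a] in the two trees both have their parents in
    the part of the opposite queue that is common to the two trees.  Each tree
    compares them by the same criterion, parent first and [ordS] next, so they
    are equal. *)
Lemma next_agree (a : 'I_p) (b : nat) : 0 < a ->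
  (forall x : 'I_p, x < a -> X x = X' x) ->
  (forall y : 'I_q, y < b -> Y y = Y' y) ->
  h a < b -> X a = X' a /\ h a = h' a.
Proof.
move=> a0 agreeX agreeY hab; have qX := treeX XY; have qX' := treeX XY'.
have [x' Xx'] : exists x', X' x' = X a.
  by apply: (queue_onto qX'); rewrite inE (queue_in qX) ?orbT.
have [x Xx] : exists x, X x = X' a.
  by apply: (queue_onto qX); rewrite inE (queue_in qX') ?orbT.
have ax' : a <= x'.
  rewrite leqNgt; apply/negP => x'a; move: (x'a); rewrite (_ : x' = a) ?ltnn //.
  by apply: (queue_inj qX); rewrite agreeX.
have ax : a <= x.
  rewrite leqNgt; apply/negP => xa; move: (xa); rewrite (_ : x = a) ?ltnn //.
  by apply: (queue_inj qX'); rewrite -agreeX.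
have hx' := same_parent ST XY XY' cc' a0 (leq_trans a0 ax') (esym Xx') agreeY hab.
have [ax'E|/eqP nax'] := eqVneq a x'; first by rewrite {2 4}ax'E.
have {}ax' : a < x' by rewrite ltn_neqAle ax' andbT; apply/eqP => /val_inj.
have {}ax : a < x.
  rewrite ltn_neqAle ax andbT; apply/eqP => /val_inj ax'E; apply: nax'.
  by apply: (queue_inj qX'); rewrite Xx' -Xx ax'E.
have o' := queue_ord qX' a0 ax'; have o := queue_ord qX a0 ax.
have ha'b : h' a < b.
  by apply: leq_ltn_trans hab; rewrite hx'; case: o' => [/ltnW|[->]].
have agreeY' (y : 'I_q) : y < b -> Y' y = Y y by move/agreeY.
have x0 := leq_trans a0 (ltnW ax).
have hx := same_parent ST XY' XY (esym cc') a0 x0 (esym Xx) agreeY' ha'b.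
move: o o'; rewrite Xx' Xx hx' hx.
by case=> [?|[/(congr1 val)/= ? ?]] [?|[/(congr1 val)/= ? ?]]; lia.
Qed.

End NextVertex.

Section Agreement.
Variables (p q : nat) (S T : {set V}) (ordS ordT : V -> nat).
Variables (X X' : 'I_p -> V) (Y Y' : 'I_q -> V).
Variables (h h' : 'I_p -> 'I_q) (k k' : 'I_q -> 'I_p).
Hypothesis ST : bipartite_off G s S T.
Hypothesis XY : queue_tree G s S T ordS ordT X Y h k.
Hypothesis XY' : queue_tree G s S T ordS ordT X' Y' h' k'.
Hypothesis cc' : tree_config G X Y h k = tree_config G X' Y' h' k'.

(** When the trees agree on [a] columns and [b] rows, the cell [(a, b)] does not
    satisfy both [a <= k b] and [b <= h a], so one of the two next vertices has
    its parent in the common part and the agreement extends to it. *)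
Lemma queue_tree_agree t : t + 2 <= p + q -> 0 < p -> 0 < q -> exists a b,
  [/\ a + b = t + 2, 0 < a <= p, 0 < b <= q,
    forall x : 'I_p, x < a -> X x = X' x /\ h x = h' x
  & forall y : 'I_q, y < b -> Y y = Y' y /\ k y = k' y].
Proof.
have TS := bipartite_off_sym ST.
have YX := queue_tree_sym XY; have YX' := queue_tree_sym XY'.
have dd' : tree_config G Y X k h = tree_config G Y' X' k' h'.
  by rewrite tree_config_sym cc' tree_config_sym.
move=> tpq p0 q0; elim: t tpq => [_|t IH tpq].
  exists 1, 1; split=> // z; rewrite ltnS leqn0 => /eqP z0.
    rewrite (queue_root (treeX XY)) // (queue_root (treeX XY')) //; split=> //.
    by apply: val_inj => /=; rewrite (tree_parent0 XY) // (tree_parent0 XY').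
  rewrite (queue_root (treeY XY)) // (queue_root (treeY XY')) //; split=> //.
  by apply: val_inj => /=; rewrite (tree_parent0 YX) // (tree_parent0 YX').
have [|a [b [abt /andP[a0 ap] /andP[b0 bq] aX aY]]] := IH; first by lia.
have aX1 (x : 'I_p) : x < a -> X x = X' x by move/aX=> [].
have aY1 (y : 'I_q) : y < b -> Y y = Y' y by move/aY=> [].
have growX (lt_ap : a < p) : h (Ordinal lt_ap) < b -> exists a b,
  [/\ a + b = t.+1 + 2, 0 < a <= p, 0 < b <= q,
    forall x : 'I_p, x < a -> X x = X' x /\ h x = h' x
  & forall y : 'I_q, y < b -> Y y = Y' y /\ k y = k' y].
  move=> hab; exists a.+1, b; rewrite b0 bq lt_ap; split=> //; first by lia.
  move=> x; rewrite ltnS leq_eqVlt => /orP[/eqP xa|/aX //].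
  have -> : x = Ordinal lt_ap by apply: val_inj.
  exact: (next_agree ST XY XY' cc' (a := Ordinal lt_ap) (b := b)).
have growY (lt_bq : b < q) : k (Ordinal lt_bq) < a -> exists a b,
  [/\ a + b = t.+1 + 2, 0 < a <= p, 0 < b <= q,
    forall x : 'I_p, x < a -> X x = X' x /\ h x = h' x
  & forall y : 'I_q, y < b -> Y y = Y' y /\ k y = k' y].
  move=> hab; exists a, b.+1; rewrite a0 ap lt_bq; split=> //; first by lia.
  move=> y; rewrite ltnS leq_eqVlt => /orP[/eqP yb|/aY //].
  have -> : y = Ordinal lt_bq by apply: val_inj.
  exact: (next_agree TS YX YX' dd' (a := Ordinal lt_bq) (b := a)).
have [lt_ap|pa] := ltnP a p; last first.
  have lt_bq : b < q by lia.
  by apply: (growY lt_bq); have := ltn_ord (k (Ordinal lt_bq)); lia.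
have [lt_bq|qb] := ltnP b q; last first.
  by apply: (growX lt_ap); have := ltn_ord (h (Ordinal lt_ap)); lia.
have [/growX //|bh] := ltnP (h (Ordinal lt_ap)) b.
have [/growY //|ak] := ltnP (k (Ordinal lt_bq)) a.
have [a00 _] := tree_noncrossing XY (x := Ordinal lt_ap) (y := Ordinal lt_bq) ak bh.
by rewrite /= in a00; move: a0; rewrite a00.
Qed.

Lemma queue_tree_inj : 0 < p -> 0 < q ->
  [/\ X = X', Y = Y', h = h' & k = k'].
Proof.
move=> p0 q0; have [|a [b [ab /andP[a0 ap] /andP[b0 bq] aX aY]]] :=
  queue_tree_agree (t := p + q - 2) _ p0 q0; first by lia.
have lt_a (x : 'I_p) : x < a by have := ltn_ord x; lia.
have lt_b (y : 'I_q) : y < b by have := ltn_ord y; lia.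
by split; apply/funext => z; [case: (aX z)|case: (aY z)|case: (aX z)|case: (aY z)].
Qed.

End Agreement.
End Injectivity.

(** * Every recurrent configuration comes from a queue tree *)

Section Parent.
Variables (V : finType) (G : sgraph V) (s : V) (c : config V).
Implicit Types (Y : seq V) (v : V).

(** The number of grains which [v] must receive in order to topple. *)
Definition need v := deg G v - c v.

Definition enabled Y v := need v <= count (G v) Y.

Definition parent Y v :=
  find (fun j => need v <= count (G v) (take j.+1 Y)) (iota 0 (size Y)).

Lemma count_nbrs_takeS Y v j : j < size Y ->
  count (G v) (take j.+1 Y) = count (G v) (take j Y) + G v (nth s Y j).
Proof. by move=> jY; rewrite (take_nth s jY) -cats1 count_cat /= addn0. Qed.

Lemma has_parent Y v : 0 < need v -> (parent Y v < size Y) = enabled Y v.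
Proof.
move=> v0; rewrite /parent -[X in _ < X](size_iota 0) -has_find.
apply/hasP/idP => [[j]|en].
  rewrite mem_iota => /= jY /leq_trans; apply.
  by rewrite -[X in _ <= count _ X](cat_take_drop j.+1) count_cat leq_addr.
have Y0 : 0 < size Y by case: Y en => //; rewrite /enabled /=; lia.
exists (size Y).-1; first by rewrite mem_iota /=; lia.
by rewrite prednK // take_size.
Qed.

Lemma parent_count Y v : 0 < need v -> enabled Y v ->
  G v (nth s Y (parent Y v)) /\ count (G v) (take (parent Y v).+1 Y) = need v.
Proof.
move=> v0 en; have pY := en; rewrite -has_parent // in pY.
have ge : need v <= count (G v) (take (parent Y v).+1 Y).
  have := @nth_find _ 0 (fun j => need v <= count (G v) (take j.+1 Y))
    (iota 0 (size Y)).
  by rewrite nth_iota //; apply; rewrite has_find size_iota.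
have lt : count (G v) (take (parent Y v) Y) < need v.
  case E: (parent Y v) => [|j]; first by rewrite take0.
  have jp : j < parent Y v by rewrite E.
  have := before_find 0 jp; rewrite nth_iota ?add0n => [/negbT|].
    by rewrite -ltnNge.
  exact: ltn_trans pY.
move: ge; rewrite count_nbrs_takeS //; case: (G v _); last by lia.
by split=> //; lia.
Qed.

Lemma enabled_rcons Y v w : enabled Y v -> enabled (rcons Y w) v.
Proof. by move=> en; rewrite /enabled -cats1 count_cat (leq_trans en) ?leq_addr. Qed.

(** Queueing [w] does not move the parent of an enabled vertex, and the vertices
    that [w] enables have it as parent, hence come after all the others. *)
Lemma parent_rcons Y v w : 0 < need v ->
  if enabled Y v then parent (rcons Y w) v = parent Y v
  else size Y <= parent (rcons Y w) v.
Proof.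
move=> v0; pose a Y := fun j => need v <= count (G v) (take j.+1 Y).
have aE : {in iota 0 (size Y), a (rcons Y w) =1 a Y}.
  by move=> j; rewrite mem_iota /a => /= jY; rewrite -cats1 takel_cat.
have -> : parent (rcons Y w) v =
    if has (a Y) (iota 0 (size Y)) then parent Y v
    else size Y + find (a (rcons Y w)) [:: size Y].
  rewrite {1}/parent size_rcons -[(size Y).+1]addn1 iotaD find_cat size_iota.
  by rewrite (eq_in_has aE) (eq_in_find aE).
rewrite -has_parent // has_find size_iota /parent -/(a Y).
by case: ifP => ->; rewrite ?leq_addr.
Qed.

Lemma parent_root Y : need s = 0 -> parent Y s = 0.
Proof. by move=> s0; rewrite /parent s0; case: Y. Qed.

End Parent.

Section Greedy.
Variables (V : finType) (G : sgraph V) (s : V) (c : config V) (M : nat).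
Hypothesis needs : need G c s = 0.
Hypothesis need_gt0 : forall v, v != s -> 0 < need G c v.

Notation need := (need G c).
Notation enabled := (enabled G c).
Notation parent := (parent G c).

(** The pair of the position of the parent and of [ord v], ordered
    lexicographically, is encoded as one number in base [M]: [ord v < M]. *)
Definition key (ord : V -> nat) Y v := parent Y v * M + ord v.

(** [X] is an initial segment of the enabled vertices of [S] sorted by key. *)
Record initial_segment (S : {set V}) ord (X Y : seq V) : Prop := InitialSegment {
  seg_sub : {subset X <= S};
  seg_enabled : forall v, v \in X -> enabled Y v;
  seg_sorted : pairwise (relpre (key ord Y) ltn) X;
  seg_min : forall v w, v \in X -> w \in S -> w \notin X -> enabled Y w ->
    key ord Y v < key ord Y w
}.

(** Both queues include the root here, whereas the segment [X] of
    [initial_segment] starts after it. *)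
Definition noncrossing X Y := forall x y, x < size X -> y < size Y ->
  x <= parent X (nth s Y y) -> y <= parent Y (nth s X x) -> x = 0 /\ y = 0.

Record partial_tree (S T : {set V}) ordS ordT (X Y : seq V) : Prop := PartialTree {
  partialX : initial_segment S ordS X (s :: Y);
  partialY : initial_segment T ordT Y (s :: X);
  partial_nc : noncrossing (s :: X) (s :: Y)
}.

Lemma partial_tree_sym S T ordS ordT X Y :
  partial_tree S T ordS ordT X Y -> partial_tree T S ordT ordS Y X.
Proof.
case=> pX pY nc; split=> // y x yY xX yx xy.
by have [-> ->] := nc _ _ xX yY xy yx.
Qed.

Section Grow.
Variables (S T : {set V}) (ordS ordT : V -> nat).
Hypothesis ST : bipartite_off G s S T.
Hypotheses (ordS_inj : injective ordS) (ordS_lt : forall v, ordS v < M).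
Hypothesis ordT_lt : forall v, ordT v < M.

Lemma key_inj Y : injective (key ordS Y).
Proof.
move=> v w /(congr1 (modn^~ M)); rewrite !modnMDl !modn_small //; exact: ordS_inj.
Qed.

Lemma need_gt0T v : v \in T -> 0 < need v.
Proof.
by move=> vT; apply: need_gt0; apply: contraTneq vT => ->; exact: off_rootT ST.
Qed.

Lemma segment_grow X Y v : initial_segment S ordS X Y ->
  v \in S -> v \notin X -> enabled Y v ->
  exists w, [/\ w \in S, w \notin X, enabled Y w
    & initial_segment S ordS (rcons X w) Y].
Proof.
move=> [sub en sorted_ min_] vS vX env.
pose cand := [pred w | [&& w \in S, w \notin X & enabled Y w]].
have candv : cand v by rewrite /cand /= vS vX.
have [w /and3P[wS wX enw] wmin] := arg_minnP (key ordS Y) candv.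
exists w; split=> //; split=> [u|u||u u'].
- by rewrite mem_rcons inE => /orP[/eqP->|/sub].
- by rewrite mem_rcons inE => /orP[/eqP->|/en].
- rewrite pairwise_rcons sorted_ andbT; apply/allP => u uX; exact: min_.
- rewrite !mem_rcons !inE negb_or => + u'S /andP[u'w u'X] enu'.
  case/orP=> [/eqP->|uX]; last exact: min_.
  rewrite ltn_neqAle wmin ?andbT /cand /= ?u'S ?u'X //.
  by rewrite (inj_eq (@key_inj Y)) eq_sym.
Qed.

Lemma segment_other X Y w : initial_segment T ordT X Y ->
  initial_segment T ordT X (rcons Y w).
Proof.
move=> [sub en sorted_ min_].
have keyE v : v \in T -> enabled Y v -> key ordT (rcons Y w) v = key ordT Y v.
  by move=> vT env; have := parent_rcons Y w (need_gt0T vT); rewrite env /key => ->.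
split=> // [v /en|| v u vX uT uX enu].
- exact: enabled_rcons.
- apply: (sub_in_pairwise (P := mem X)) sorted_; last exact/allP.
  by move=> v u vX uX /=; rewrite !keyE ?sub ?en.
rewrite keyE ?sub ?en //; have [enY|nenY] := boolP (enabled Y u).
  by rewrite keyE // min_.
have := parent_rcons Y w (need_gt0T uT); rewrite (negPf nenY) => pu.
have pv : parent Y v < size Y by rewrite has_parent ?en ?need_gt0T ?sub.
rewrite /key; apply: leq_trans (leq_addr _ _).
apply: leq_trans (leq_mul (leq_trans pv pu) (leqnn M)).
by rewrite mulSn addnC ltn_add2r.
Qed.

(** A new vertex cannot create a crossing: its position is larger than the
    position of the parent of any vertex of the opposite queue. *)
Lemma partial_tree_grow X Y v : partial_tree S T ordS ordT X Y ->
  v \in S -> v \notin X -> enabled (s :: Y) v ->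
  exists w, partial_tree S T ordS ordT (rcons X w) Y.
Proof.
move=> [pX pY nc] vS vX env.
have [w [wS wX enw pXw]] := segment_grow pX vS vX env.
exists w; split=> //; first by rewrite -rcons_cons; exact: segment_other.
(* The parents of the vertices of [Y] lie in the old part of the queue [X]. *)
have parY y : y < size (s :: Y) -> let u := nth s (s :: Y) y in
    parent (s :: rcons X w) u = parent (s :: X) u /\ parent (s :: X) u < size (s :: X).
  case: y => [|y] /= yY; first by rewrite !parent_root.
  have uY : nth s Y y \in Y by rewrite mem_nth.
  have u0 := need_gt0T (seg_sub pY uY).
  have := parent_rcons (s :: X) w u0; rewrite (seg_enabled pY uY) => ->.
  by rewrite -[X in _ < X]/(size (s :: X)) has_parent // (seg_enabled pY uY).
move=> x y xX yY; have [-> pyX] := parY y yY => xy.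
have {}xX : x < size (s :: X) by exact: leq_ltn_trans pyX.
rewrite -rcons_cons nth_rcons xX; exact: nc.
Qed.

End Grow.

Section Complete.
Variables (S T : {set V}) (ordS ordT : V -> nat).
Hypothesis ST : bipartite_off G s S T.
Hypotheses (ordS_inj : injective ordS) (ordS_lt : forall v, ordS v < M).
Hypotheses (ordT_inj : injective ordT) (ordT_lt : forall v, ordT v < M).
Hypothesis crit : forall U : {set V}, s \notin U -> U != set0 ->
  exists2 v, v \in U & nbrs_in G U v <= c v.

(** [c v] bounds the number of neighbours of [v] outside the queues, so the
    queues contain at least [deg v - c v] of them; as [v] is in [S'], these
    all lie in the queue opposite to its own. *)
Lemma criterion_enabled S' T' (X Y : seq V) v : bipartite_off G s S' T' ->
  v \in S' -> nbrs_in G [set u | [&& u != s, u \notin X & u \notin Y]] v <= c v ->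
  {subset X <= S'} ->
  enabled (s :: Y) v.
Proof.
move=> ST' vS; set U := [set u | _] => vc XS.
rewrite /enabled /need leq_subLR (deg_split G U) leq_add // -size_filter.
apply: leq_trans (card_size _); apply: subset_leq_card; apply/fintype.subsetP => u.
rewrite !inE mem_filter => /andP[uU vu]; rewrite vu inE.
have /setU1P[->|uT] := off_nbrS ST' vS vu; first by rewrite eqxx.
move: uU; rewrite !negb_and !negbK => /or3P[->//|/XS uS|->]; last by rewrite orbT.
by move: (off_disj ST' uS); rewrite uT.
Qed.

(** While some vertex other than the root is in neither queue, the criterion
    applied to the set of these vertices makes one of them enabled. *)
Lemma partial_tree_complete :
  exists X Y, [/\ partial_tree S T ordS ordT X Y, X =i S & Y =i T].
Proof.
have TS := bipartite_off_sym ST.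
(* Growth for more than [#|V| + #|V|] steps would overflow the two queues. *)
suff grow (t : nat) :
    (exists X Y, partial_tree S T ordS ordT X Y /\ size X + size Y = t) \/
    exists X Y, [/\ partial_tree S T ordS ordT X Y, X =i S & Y =i T].
  have [[X [Y [[pX pY _] sXY]]]|//] := grow (#|V| + #|V|).+1.
  have Xu : uniq X by apply: pairwise_uniq (seg_sorted pX) => v; exact: ltnn.
  have Yu : uniq Y by apply: pairwise_uniq (seg_sorted pY) => v; exact: ltnn.
  have := max_card (mem X); have := max_card (mem Y).
  by rewrite (card_uniqP Xu) (card_uniqP Yu); lia.
elim: t => [|t [[X [Y [pXY sXY]]]|]]; last by right.
  left; exists [::], [::]; split=> //; split=> // x y.
  by rewrite !ltnS !leqn0 => /eqP-> /eqP->.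
pose U := [set u | [&& u != s, u \notin X & u \notin Y]].
have [pX pY _] := pXY; have [XS YT] := (seg_sub pX, seg_sub pY).
have [U0|U0] := eqVneq U set0.
  have out u : u != s -> (u \in X) || (u \in Y).
    move=> us; have : u \notin U by rewrite U0 inE.
    by rewrite inE us /= -negb_or negbK.
  right; exists X, Y; split=> // u; apply/idP/idP; [exact: XS| |exact: YT|] => uS.
    have us : u != s by apply: contraTneq uS => ->; exact: off_rootS ST.
    have /orP[//|/YT] := out u us; by rewrite (negPf (off_disj ST uS)).
  have us : u != s by apply: contraTneq uS => ->; exact: off_rootT ST.
  have /orP[/XS|//] := out u us; by rewrite (negPf (off_disj TS uS)).
have [|v vU vc] := crit _ U0; first by rewrite inE eqxx.
left; move: (vU); rewrite inE => /and3P[vs vX vY].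
have := off_cover ST v; rewrite (negPf vs) /= => /orP[vS|vT].
  have env := criterion_enabled ST vS vc XS.
  have [w pXw] := partial_tree_grow ST ordS_inj ordS_lt ordT_lt pXY vS vX env.
  by exists (rcons X w), Y; rewrite size_rcons addSn sXY.
have envT : enabled (s :: X) v.
  apply: (criterion_enabled TS vT _ YT); rewrite (_ : [set u | _] = U) //.
  by apply/setP => u; rewrite !inE andbC [X in X && _]andbC andbC [X in _ && X]andbC.
have pYX := partial_tree_sym pXY.
have [w pYw] := partial_tree_grow TS ordT_inj ordT_lt ordS_lt pYX vT vY envT.
exists X, (rcons Y w); rewrite size_rcons addnS sXY; split=> //.
exact: partial_tree_sym.
Qed.

End Complete.
End Greedy.

Lemma count_take_ord (V : Type) (s : V) (a : pred V) q (L : seq V) (j : 'I_q) :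
  size L = q ->
  count a (take j.+1 L) = #|[pred y : 'I_q | (y <= j) && a (nth s L y)]|.
Proof.
move=> sL; rewrite -sum1_count (big_nth s) size_takel ?sL //.
rewrite (big_nat_widen _ _ q) // big_mkord -sum1_card; apply: eq_bigl => y.
by rewrite inE ltnS andbC; case: leqP => // yj; rewrite nth_take.
Qed.

Section SeqTree.
Variables (V : finType) (G : sgraph V) (s : V) (c : config V) (M : nat).
Hypothesis needs : need G c s = 0.
Hypothesis need_gt0 : forall v, v != s -> 0 < need G c v.

Section SeqQueue.
Variables (p q : nat) (S T : {set V}) (ordS ordT : V -> nat) (X Y : seq V).
Variables (Xf : 'I_p -> V) (Yf : 'I_q -> V) (h : 'I_p -> 'I_q).
Hypothesis ST : bipartite_off G s S T.
Hypotheses (ordS_lt : forall v, ordS v < M).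
Hypothesis pXY : partial_tree G s c M S T ordS ordT X Y.
Hypotheses (XS : X =i S) (YT : Y =i T).
Hypotheses (sX : size (s :: X) = p) (sY : size (s :: Y) = q).
Hypothesis XfE : forall x, Xf x = nth s (s :: X) x.
Hypothesis YfE : forall y, Yf y = nth s (s :: Y) y.
Hypothesis hE : forall x, h x = parent G c (s :: Y) (Xf x) :> nat.

Let pX := partialX pXY.

Lemma seq_queue_in (x : 'I_p) : 0 < x -> Xf x \in X.
Proof.
rewrite XfE; case: x => -[|x] //= xp _; apply: mem_nth.
by move: xp; rewrite -[X in _ < X]sX.
Qed.

Lemma seq_queue_need (x : 'I_p) : 0 < x -> 0 < need G c (Xf x).
Proof.
move/seq_queue_in; rewrite XS => xS; apply: need_gt0.
by apply: contraTneq xS => ->; exact: off_rootS ST.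
Qed.

Lemma seq_queue : queue G s S ordS Xf Yf h.
Proof.
have uX : uniq (s :: X).
  rewrite /= XS (off_rootS ST); apply: pairwise_uniq (seg_sorted pX) => v; exact: ltnn.
split=> [x x'|v|x x0|x /seq_queue_in|x x0|x x' x0 xx'].
- by rewrite !XfE => /eqP; rewrite nth_uniq ?sX // => /eqP/val_inj.
- rewrite in_setU1 -XS -in_cons => vX.
  have vp : index v (s :: X) < p by rewrite -sX index_mem.
  by exists (Ordinal vp); rewrite XfE nth_index.
- by rewrite XfE x0.
- by rewrite XS.
- have [+ _] := parent_count s (seq_queue_need x0) (seg_enabled pX (seq_queue_in x0)).
  by rewrite YfE hE.
have : relpre (key G c M ordS (s :: Y)) ltn (Xf x) (Xf x').
  have := pairwiseP s (seg_sorted pX); move/(_ x.-1 x'.-1); rewrite !inE.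
  have Xp z : nth s X z = nth s (s :: X) z.+1 by [].
  rewrite !Xp !prednK -?XfE //; last exact: ltn_trans xx'.
  by apply; have := ltn_ord x; have := ltn_ord x'; have /= := sX; lia.
rewrite /= /key -!hE => lt; have := ordS_lt (Xf x').
case: (ltngtP (h x) (h x')) => [|hx' ox'|hh']; first by left.
  have := leq_mul hx' (leqnn M); rewrite mulSn; lia.
by right; split; [exact: val_inj | move: lt; rewrite hh' ltn_add2l].
Qed.

(** Both sides are the number of neighbours minus [need]: the parent was chosen
    as the neighbour number [need] of the vertex. *)
Lemma seq_queue_config (k : 'I_q -> 'I_p) (x : 'I_p) :
  queue_tree G s S T ordS ordT Xf Yf h k -> 0 < x ->
  tree_config G Xf Yf h k (Xf x) = c (Xf x).
Proof.
move=> XYf x0; have := tree_config_queue_deg ST XYf x0.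
have [_ +] := parent_count s (seq_queue_need x0) (seg_enabled pX (seq_queue_in x0)).
rewrite -hE (@count_take_ord _ s _ q) // => eq_need.
rewrite (_ : #|_| = need G c (Xf x)); last first.
  by rewrite -eq_need; apply: eq_card => y; rewrite !inE YfE.
have := seq_queue_need x0; rewrite /need; lia.
Qed.

End SeqQueue.

Lemma queue_tree_exists p q S T ordS ordT : bipartite_off G s S T ->
  #|S| = p.-1 -> #|T| = q.-1 -> 0 < p -> 0 < q ->
  injective ordS -> injective ordT ->
  (forall v, ordS v < M) -> (forall v, ordT v < M) ->
  c s = deg G s ->
  (forall U : {set V}, s \notin U -> U != set0 ->
    exists2 v, v \in U & nbrs_in G U v <= c v) ->
  exists (X : 'I_p -> V) (Y : 'I_q -> V) h k,
    queue_tree G s S T ordS ordT X Y h k /\ tree_config G X Y h k = c.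
Proof.
move=> ST cS cT p0 q0 iS iT ltS ltT cs crit; have TS := bipartite_off_sym ST.
have [X [Y [pXY XS YT]]] := partial_tree_complete needs need_gt0 ST iS ltS iT ltT crit.
have pYX := partial_tree_sym pXY.
have Xu : uniq X by apply: pairwise_uniq (seg_sorted (partialX pXY)) => v; exact: ltnn.
have Yu : uniq Y by apply: pairwise_uniq (seg_sorted (partialY pXY)) => v; exact: ltnn.
have sX : size (s :: X) = p by rewrite /= -(card_uniqP Xu) (eq_card XS) cS prednK.
have sY : size (s :: Y) = q by rewrite /= -(card_uniqP Yu) (eq_card YT) cT prednK.
pose Xf (x : 'I_p) := nth s (s :: X) x; pose Yf (y : 'I_q) := nth s (s :: Y) y.
have /choice[h hE] (x : 'I_p) : exists j : 'I_q, j = parent G c (s :: Y) (Xf x) :> nat.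
  suff lt : parent G c (s :: Y) (Xf x) < q by exists (Ordinal lt).
  have [x0|x0] := posnP x; first by rewrite /Xf x0 /= parent_root.
  rewrite -sY has_parent; last exact: (seq_queue_need ST XS sX).
  exact/(seg_enabled (partialX pXY))/(seq_queue_in (Xf := Xf) sX).
have /choice[k kE] (y : 'I_q) : exists j : 'I_p, j = parent G c (s :: X) (Yf y) :> nat.
  suff lt : parent G c (s :: X) (Yf y) < p by exists (Ordinal lt).
  have [y0|y0] := posnP y; first by rewrite /Yf y0 /= parent_root.
  rewrite -sX has_parent; last exact: (seq_queue_need TS YT sY).
  exact/(seg_enabled (partialX pYX))/(seq_queue_in (Xf := Yf) sY).
have XYf : queue_tree G s S T ordS ordT Xf Yf h k.
  split=> [||x y]; first exact: (seq_queue ST ltS pXY XS sX).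
    exact: (seq_queue TS ltT pYX YT sY).
  rewrite hE kE; apply: (partial_nc pXY); rewrite ?sX ?sY //.
exists Xf, Yf, h, k; split=> //; apply/ffunP => v.
have [->|vs] := eqVneq v s; first by rewrite (tree_config_root p0 q0 ST XYf).
have [[x x0 <-]|[y y0 <-]] := tree_vertex ST XYf vs.
  exact: (seq_queue_config ST pXY XS sX sY).
rewrite -tree_config_sym.
exact: (seq_queue_config TS pYX YT sY sX _ _ _ (queue_tree_sym XYf)).
Qed.

End SeqTree.

(** * Lattice paths as monotone functions *)

Section LatticePath.
Implicit Types (r g : seq bool).

Lemma count_take_le (a : pred bool) r k l : k <= l ->
  count a (take k r) <= count a (take l r).
Proof.
by move=> kl; rewrite -(subnKC kl) takeD count_cat leq_addr.
Qed.

Lemma count_takeS (a : pred bool) r k : k < size r ->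
  count a (take k.+1 r) = count a (take k r) + a (nth false r k).
Proof. by move=> kr; rewrite (take_nth false kr) -cats1 count_cat /= addn0. Qed.

Lemma pointD r k : k <= size r -> (point r k).1 + (point r k).2 = k.
Proof.
move=> kr; rewrite addnC -[RHS](size_takel kr) -(count_predC id); congr addn.
Qed.

Lemma count_take_ivt (a : pred bool) r k x : x <= count a (take k r) ->
  exists2 l, l <= k & count a (take l r) = x.
Proof.
elim: k => [|k IH]; first by rewrite take0 leqn0 => /eqP->; exists 0; rewrite ?take0.
have [kr|rk] := ltnP k (size r); last first.
  have -> : take k.+1 r = take k r by rewrite !take_oversize ?leqW.
  by case/IH=> l lk <-; exists l; rewrite ?leqW.
rewrite leq_eqVlt => /orP[/eqP->|]; first by exists k.+1.
rewrite count_takeS // => xk; have [|l lk <-] := IH; last by exists l; rewrite ?leqW.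
by case: (a _) xk; rewrite ?addn1 ?addn0 // => /ltnW.
Qed.

(** Reflection in the diagonal exchanges the two kinds of steps; the east steps
    of the green path are studied as the north steps of its reflection. *)
Lemma point_negb r k : point (map negb r) k = ((point r k).2, (point r k).1).
Proof.
rewrite /point -map_take !count_map /=; congr pair; apply: eq_count => b //=.
by rewrite negbK.
Qed.

(** [F y] is the abscissa of the north step of [r] in row [y], for a path to
    [(p, q)]; this step starts at [(F y, y)], and so is step number [F y + y]. *)
Definition north_steps (p q : nat) r (F : 'I_q -> nat) : Prop :=
  [/\ size r = p + q,
      forall k, k < p + q -> nth false r k = [exists y, F y + y == k],
      forall y y' : 'I_q, y <= y' -> F y <= F y'
    & forall y, F y <= p].

Section NorthSteps.
Variables (p q : nat) (r : seq bool) (F : 'I_q -> nat).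
Hypothesis rF : north_steps p r F.

Lemma north_step_inj y y' : F y + y = F y' + y' -> y = y'.
Proof.
case: rF => _ _ Fle _ e; apply: val_inj => /=.
have [yy'|/ltnW yy'] := leqP y y'; have := Fle _ _ yy'; lia.
Qed.

Lemma north_step_lt y : F y + y < p + q.
Proof. case: rF => _ _ _ /(_ y); have := ltn_ord y; lia. Qed.

Lemma count_north k : k <= p + q ->
  count id (take k r) = #|[pred y | F y + y < k]|.
Proof.
case: rF => sr rE _ _; elim: k => [|k IH] kpq.
  by rewrite take0 eq_card0.
rewrite count_takeS ?sr // (IH (ltnW kpq)) rE //.
rewrite -[RHS](cardID [pred y | F y + y == k]) addnC; congr addn; last first.
  by apply: eq_card => y; rewrite !inE /=; lia.
case: existsP => [[y /eqP yk]|ny]; last first.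
  apply/esym/eq_card0 => y; rewrite !inE /=; apply/negP => /andP[_ yk].
  by apply: ny; exists y.
transitivity #|pred1 y|; first by rewrite card1.
apply: eq_card => y'; rewrite !inE /= -yk.
apply/eqP/andP => [->|[_ /eqP/north_step_inj //]]; by rewrite leqnn.
Qed.

Lemma point_north_step y : point r (F y + y) = (F y, val y).
Proof.
have c2 : (point r (F y + y)).2 = y.
  rewrite /= (count_north (ltnW (north_step_lt y))).
  rewrite -[RHS](card_ord y) -sum1_card -[RHS]sum1_card.
  rewrite (big_ord_widen q (fun _ => 1)) ?(ltnW (ltn_ord y)) //; apply: eq_bigl => y'.
  rewrite !inE /=; case: rF => _ _ Fle _.
  by have [yy'|yy'] := leqP y y'; [have := Fle _ _ yy'|have := Fle _ _ (ltnW yy')]; lia.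
have [sr _ _ _] := rF; have := @pointD r (F y + y).
rewrite sr (ltnW (north_step_lt y)) => /(_ isT); rewrite c2.
by move/addIn; case: (point _ _) c2 => a b /= -> ->.
Qed.

Lemma nth_north_step y : nth false r (F y + y).
Proof.
case: rF => _ rE _ _; rewrite rE ?north_step_lt //.
by apply/existsP; exists y.
Qed.

Lemma count_north_steps : count id r = q.
Proof.
have [sr _ _ _] := rF; rewrite -[r]take_size sr count_north //.
rewrite -[RHS]card_ord; apply: eq_card => y; rewrite !inE; exact: north_step_lt.
Qed.

Lemma point_north_le k (y : 'I_q) : (point r k).2 <= y -> (point r k).1 <= F y.
Proof.
have [sr _ _ _] := rF; have [ky _|yk] := leqP k (F y + y).
  have <- : (point r (F y + y)).1 = F y by rewrite point_north_step.
  exact: count_take_le.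
have := count_take_le id r yk; rewrite count_takeS ?nth_north_step; last first.
  by rewrite sr north_step_lt.
have /= -> := congr1 snd (point_north_step y); lia.
Qed.

Lemma point_north_ge k (y : 'I_q) : y < (point r k).2 -> F y <= (point r k).1.
Proof.
have [ky|yk _] := leqP k (F y + y).
  have := count_take_le id r ky.
  by have /= -> := congr1 snd (point_north_step y); lia.
have <- : (point r (F y + y)).1 = F y by rewrite point_north_step.
exact/count_take_le/ltnW.
Qed.

End NorthSteps.

Lemma north_step_ex r y : y < count id r ->
  exists k, [/\ k < size r, nth false r k & count id (take k r) = y].
Proof.
elim: r y => [|[] r IH] y //=; last first.
  by case/IH=> k [kr rk <-]; exists k.+1.
case: y => [|y]; first by exists 0.
by rewrite ltnS => /IH[k [kr rk <-]]; exists k.+1.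
Qed.

Lemma north_steps_ex p q r : size r = p + q -> count id r = q ->
  exists F : 'I_q -> nat, north_steps p r F.
Proof.
move=> sr cr.
have /choice[K KP] (y : 'I_q) :
  exists k, [/\ k < size r, nth false r k & count id (take k r) = y].
  by apply: north_step_ex; rewrite cr.
have F1 y : (point r (K y)).1 + y = K y.
  by have [Kr _ cK] := KP y; rewrite -[RHS](pointD (ltnW Kr)) /= cK.
exists (fun y => (point r (K y)).1); split=> // [k kpq|y y' yy'|y].
- apply/idP/existsP => [rk|[y /eqP<-]]; last by rewrite F1; have [] := KP y.
  have kr : k < size r by rewrite sr.
  have kq : count id (take k r) < q.
    rewrite -cr -{2}(take_size r).
    by apply: leq_trans (count_take_le id r kr); rewrite count_takeS // rk addn1.
  exists (Ordinal kq); rewrite F1 /=; have [Kr rK cK] := KP (Ordinal kq).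
  apply/eqP; case: (ltngtP (K (Ordinal kq)) k) => // /(count_take_le id r).
    by rewrite count_takeS // rK cK /=; lia.
  by rewrite count_takeS // rk cK /=; lia.
- have [Kr rK cK] := KP y; have [Kr' rK' cK'] := KP y'.
  apply: count_take_le; case: leqP => // /(count_take_le id r).
  by rewrite count_takeS // rK'; lia.
- have := count_take_le negb r (ltnW (let: And3 h _ _ := KP y in h)).
  rewrite take_size; have := count_predC id r.
  have -> : count (predC id) r = count negb r by [].
  by rewrite cr sr /=; lia.
Qed.

Lemma north_steps_mk p q (F : 'I_q -> nat) :
  (forall y y' : 'I_q, y <= y' -> F y <= F y') -> (forall y, F y <= p) ->
  north_steps p (mkseq (fun k => [exists y, F y + y == k]) (p + q)) F.
Proof.
by move=> Fle Fp; split; rewrite ?size_mkseq // => k kpq; rewrite nth_mkseq.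
Qed.

Lemma north_steps_uniq p q r r' (F : 'I_q -> nat) :
  north_steps p r F -> north_steps p r' F -> r = r'.
Proof.
case=> sr rE _ _ [sr' rE' _ _]; apply: (@eq_from_nth _ false); rewrite ?sr //.
by move=> k kpq; rewrite rE ?rE'.
Qed.

End LatticePath.

Lemma north_stepP p q (r : seq bool) (F : 'I_q -> nat) x (y : 'I_q) :
  north_steps p r F ->
  (exists i, [/\ i < p + q, nth false r i & point r i = (x, val y)]) <-> F y = x.
Proof.
move=> rF; have [_ rE _ _] := rF; split=> [[i [ipq]]|<-].
  rewrite rE // => /existsP[y' /eqP<-]; rewrite (point_north_step rF) => -[<- yy'].
  by congr F; apply: val_inj.
exists (F y + y); rewrite (north_step_lt rF) (nth_north_step rF).
by rewrite (point_north_step rF).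
Qed.

Section TwoPaths.
Variables (m n : nat) (r g : seq bool).

Section Bounds.
Variables (F : 'I_n -> nat) (H : 'I_m -> nat).
Hypotheses (rF : north_steps m r F) (gH : north_steps n (map negb g) H).

Lemma point_green l a b : point (map negb g) l = (a, b) -> point g l = (b, a).
Proof. by rewrite point_negb /point => -[<- <-]. Qed.

Lemma count_green : count id g = n /\ count negb g = m.
Proof.
have [sg _ _ _] := gH; have cH := count_north_steps gH.
rewrite count_map in cH; rewrite size_map -(count_predC negb) cH in sg.
split; last exact: cH.
move: sg; rewrite addnC => /addIn <-; apply: eq_count => b /=; by rewrite negbK.
Qed.

Lemma count_red : count id r = n /\ count negb r = m.
Proof.
have [sr _ _ _] := rF; have cF := count_north_steps rF; split=> //.
by move: sr; rewrite -(count_predC id) cF addnC => /addIn <-.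
Qed.

(** If [x <= F y], the red path crosses abscissa [x] at height at most [y]; the
    green step of column [x] starts at height [H x], so [y <= H x] is possible
    only where the paths meet. *)
Lemma strictly_above_bounds : 0 < n -> strictly_above m n r g ->
  [/\ forall y, F y < m, forall x, H x < n
    & forall (x : 'I_m) (y : 'I_n), x <= F y -> y <= H x ->
      x = 0 :> nat /\ y = 0 :> nat].
Proof.
move=> n0 above; have [[_ _ _ Fm] [_ _ _ Hn]] := (rF, gH).
have gpt x : point g (H x + x) = (val x, H x).
  by apply: point_green; exact: (point_north_step gH).
have [cg cg'] := count_green; have [cr cr'] := count_red.
split=> [y|x|x y xF yH].
- rewrite ltn_neqAle Fm andbT; apply/eqP => Fy.
  have e : (point r (F y + y)).1 = (point g (size g)).1.
    by rewrite (point_north_step rF) /= take_size cg'.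
  have := ltn_ord y; case: (above _ _ e) => [|[+ _]]; rewrite (point_north_step rF).
    by rewrite /= take_size cg; lia.
  by case=> _ ->; rewrite take_size cg ltnn.
- rewrite ltn_neqAle Hn andbT; apply/eqP => Hx.
  have xm : x <= count negb (take (size r) r) by rewrite take_size cr' ltnW.
  have [l lr lx] := count_take_ivt xm.
  have e : (point r l).1 = (point g (H x + x)).1 by rewrite gpt.
  have := count_take_le id r lr; rewrite take_size cr.
  case: (above _ _ e) => [|[_ []]]; rewrite gpt Hx.
  + by rewrite /=; lia.
  + by case=> _ n00; rewrite n00 in n0.
  + by case=> xm' _; have := ltn_ord x; rewrite xm' ltnn.
have xr : x <= count negb (take (F y + y) r).
  by have /= -> := congr1 fst (point_north_step rF y).
have [l lr lx] := count_take_ivt xr.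
have e : (point r l).1 = (point g (H x + x)).1 by rewrite gpt.
have := count_take_le id r lr.
have /= -> := congr1 snd (point_north_step rF y).
case: (above _ _ e) => [|[_ []]]; rewrite gpt.
- by rewrite /=; lia.
- by case=> x0 Hx0; lia.
by case=> xm _; have := ltn_ord x; rewrite xm ltnn.
Qed.

End Bounds.

Lemma noncrossing_strictly_above (k : 'I_n -> 'I_m) (h : 'I_m -> 'I_n) :
  north_steps m r k -> north_steps n (map negb g) h ->
  (forall (x : 'I_m) (y : 'I_n), x <= k y -> y <= h x ->
    x = 0 :> nat /\ y = 0 :> nat) ->
  strictly_above m n r g.
Proof.
move=> rk gh nc i j; have [cg cg'] := count_green gh; have [cr cr'] := count_red rk.
have bound (a : pred bool) (t : seq bool) l : count a (take l t) <= count a t.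
  by rewrite -{2}(cat_take_drop l t) count_cat leq_addr.
have := bound id r i; have := bound negb r i.
have := bound id g j; have := bound negb g j.
rewrite cg cg' cr cr'.
case gj: (point g j) => [a b']; case ri: (point r i) => [a' b].
have gj' : point (map negb g) j = (b', a) by rewrite point_negb gj.
have [/= -> ->] := (congr1 fst gj, congr1 snd gj).
have [/= -> ->] := (congr1 fst ri, congr1 snd ri).
move=> am b'n _ bn aa'; subst a'.
have redP (y : 'I_n) : b <= y -> a <= k y.
  by have := point_north_le rk (k := i) (y := y); rewrite ri.
have greenP (x : 'I_m) : a <= x -> b' <= h x.
  by have := point_north_le gh (k := j) (y := x); rewrite gj'.
case: (ltnP b' b) => [|bb']; first by left.
right; move: am bn; rewrite (leq_eqVlt a) (leq_eqVlt b) => /orP[/eqP am|am] /orP[/eqP bn|bn].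
- have -> : b' = n by lia.
  by rewrite am bn; split=> //; right.
- by have := redP (Ordinal bn) (leqnn _); have := ltn_ord (k (Ordinal bn)); lia.
- by have := greenP (Ordinal am) (leqnn _); have := ltn_ord (h (Ordinal am)); lia.
have bh := greenP (Ordinal am) (leqnn _); have ak := redP (Ordinal bn) (leqnn _).
have [/= a0 b0] := nc (Ordinal am) (Ordinal bn) ak (leq_trans bb' bh).
have [|_ h0] := nc (Ordinal am) (h (Ordinal am)) _ (leqnn _).
  exact: leq_trans (eq_leq a0) (leq0n _).
have -> : b' = 0 by lia.
by rewrite a0 b0; split=> //; left.
Qed.

End TwoPaths.

(** * The graph of an ordered partition *)

Section GraphOfPartition.
Variables (N : nat) (pi1 pi2 pi3 : {set 'I_N}) (s : 'I_N).
Hypotheses (hpi : ordered_partition pi1 pi2 pi3) (pi2_card : #|pi2| = 1).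
Hypothesis hs : s \in pi2.
Notation G := (Gpi pi1 pi2 pi3).

Lemma pi2_sink : pi2 = [set s].
Proof.
have /eqP/cards1P[t pi2t] := pi2_card; move: hs; rewrite pi2t inE => /eqP->; by [].
Qed.

Lemma pi_disjoint :
  [/\ s \notin pi1, s \notin pi3 & forall v, v \in pi1 -> v \notin pi3].
Proof.
case: hpi => d12 d13 d23 _; split=> [||v v1].
- by apply: contraL hs => s1; rewrite (disjointFr d12 s1).
- by rewrite (disjointFr d23 hs).
- by rewrite (disjointFr d13 v1).
Qed.

(** With the sink on both sides, adjacency reads as comparison of labels. *)
Lemma Gpi_lt v w : v \in s |: pi1 -> w \in s |: pi3 -> G v w = (v < w).
Proof.
have [s1 s3 d13] := pi_disjoint.
rewrite /= /Gadj /edge_lt pi2_sink !inE => /orP[/eqP->|v1] /orP[/eqP->|w3].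
- by rewrite ltnn.
- have w1 : w \notin pi1 by apply: contraL w3 => /d13.
  by rewrite eqxx w3 (negPf s3) (negPf s1) (negPf w1) !andbF !orbF !andbT.
- have v3 := d13 _ v1.
  by rewrite eqxx v1 (negPf s3) (negPf s1) (negPf v3) !andbF !orbF !andbT.
- have w1 : w \notin pi1 by apply: contraL w3 => /d13.
  have ws : w != s by apply: contraTneq w3 => ->.
  have vs : v != s by apply: contraTneq v1 => ->.
  have v3 := d13 _ v1.
  by rewrite v1 w3 (negPf w1) (negPf v3) (negPf ws) (negPf vs) !andbF !orbF !andbT.
Qed.

Lemma Gpi_bipartite : bipartite_off G s pi1 pi3.
Proof.
have [s1 s3 d13] := pi_disjoint; case: hpi => _ _ _ cov.
split=> // [v|v w v1|v w v3].
- case: (cov v) => [->|[|->]]; rewrite ?orbT // pi2_sink inE => /eqP->.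
  by rewrite eqxx.
- have v3 := d13 _ v1; have vs : v != s by apply: contraTneq v1 => ->.
  rewrite /= /Gadj /edge_lt pi2_sink !inE (negPf v3) (negPf vs) !(andbF, orbF).
  by case/andP=> _ /orP[/andP[_ ->]|/andP[_ ->]]; rewrite ?orbT.
- have v1 : v \notin pi1 by apply: contraL v3 => /d13.
  have vs : v != s by apply: contraTneq v3 => ->.
  rewrite /= /Gadj /edge_lt pi2_sink !inE (negPf v1) (negPf vs).
  rewrite !(andFb, orFb, andbF, orbF).
  by case/andP=> _ /andP[/orP[->|->] _]; rewrite ?orbT.
Qed.

(** The sink is adjacent to an end of every edge [v < w] with [v] in [pi1] and
    [w] in [pi3]: to [v] if its label exceeds [v], and to [w] otherwise. *)
Lemma Gpi_connect v : v != s -> 0 < deg G v -> connect G s v.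
Proof.
have ST := Gpi_bipartite; have adj := Gpi_lt.
move=> vs /card_gt0P[w]; rewrite inE => vw.
have step u : G s u -> G u v -> connect G s v.
  by move=> su uv; apply: connect_trans (connect1 su) (connect1 uv).
have in1 u : u \in pi1 -> u \in s |: pi1 by rewrite inE => ->; rewrite orbT.
have in3 u : u \in pi3 -> u \in s |: pi3 by rewrite inE => ->; rewrite orbT.
have [ws|ws] := eqVneq w s; first by subst w; apply: connect1; rewrite (adj_sym G).
have := off_cover ST v; rewrite (negPf vs) /= => /orP[v1|v3].
  have w3 : w \in pi3 by have := off_nbrS ST v1 vw; rewrite !inE (negPf ws).
  have [lt|gt|/val_inj vsE] := ltngtP v s; last by rewrite vsE eqxx in vs.
    have sv : G s v by rewrite (adj_sym G) adj ?setU11 ?in1.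
    exact: connect1.
  have vw' : v < w by rewrite -adj ?in1 ?in3.
  apply: (step w); last by rewrite (adj_sym G).
  by rewrite adj ?setU11 ?in3 //; exact: ltn_trans vw'.
have w1 : w \in pi1 by have := off_nbrT ST v3 vw; rewrite !inE (negPf ws).
have [lt|gt|/val_inj vsE] := ltngtP v s; last by rewrite vsE eqxx in vs.
  have wv : w < v by rewrite -adj ?in1 ?in3 // (adj_sym G).
  apply: (step w); last by rewrite (adj_sym G).
  by rewrite (adj_sym G) adj ?setU11 ?in1 //; exact: ltn_trans lt.
have sv : G s v by rewrite adj ?setU11 ?in3.
exact: connect1.
Qed.

End GraphOfPartition.

(** * Labelled polyominoes as queue trees *)

Section Shape.
Variables (m n : nat) (P : lpoly m n) (h : 'I_m -> 'I_n) (k : 'I_n -> 'I_m).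
Hypotheses (Pk : north_steps m (red P) k) (Ph : north_steps n (map negb (green P)) h).

Lemma nth_negb_green i : i < m + n ->
  nth false (map negb (green P)) i = ~~ nth false (green P) i.
Proof. by move=> imn; rewrite (nth_map false) // size_tuple. Qed.

Lemma red_leftE x y : red_left P (x, y) = (k y == x).
Proof.
apply/existsP/eqP => [[i /andP[ri /eqP pi]]|].
  apply/val_inj/(north_stepP _ _ Pk); exists i.
  by rewrite ltn_ord -tnth_nth.
case/(congr1 val)/(north_stepP _ _ Pk)=> i [imn ri pi].
by exists (Ordinal imn); rewrite (tnth_nth false) /= ri pi eqxx.
Qed.

Lemma green_bottomE x y : green_bottom P (x, y) = (h x == y).
Proof.
apply/existsP/eqP => [[i /andP[gi /eqP pi]]|].
  apply/val_inj/(north_stepP _ _ Ph); exists i.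
  by rewrite (addnC n m) ltn_ord nth_negb_green // -tnth_nth gi point_negb pi.
case/(congr1 val)/(north_stepP _ _ Ph)=> i [inm gi pi].
rewrite (addnC n m) in inm; exists (Ordinal inm); rewrite (tnth_nth false) /=.
by rewrite -nth_negb_green // gi (point_green pi) eqxx.
Qed.

(** The red east step of column [x] lies above the square exactly when the red
    path climbs through row [y] before it leaves column [x]. *)
Lemma betweenE x y : between P (x, y) = (k y <= x) && (h x <= y).
Proof.
have [cr cr'] := count_red Pk; have [sr _ _ _] := Pk.
have [F rF] : exists F : 'I_m -> nat, north_steps n (map negb (red P)) F.
  apply: north_steps_ex; first by rewrite size_map sr addnC.
  by rewrite count_map -[RHS]cr'; apply: eq_count.
have pF := point_green (point_north_step rF x).
congr andb; apply/existsP/idP => [[i /and3P[] + + +]|].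
- rewrite /= => ri /eqP pix yi; rewrite -pix; exact: (point_north_ge Pk).
- move=> kyx; have imn := north_step_lt rF x; rewrite (addnC n m) in imn.
  exists (Ordinal imn); rewrite (tnth_nth false) pF eqxx /=.
  have := nth_north_step rF x; rewrite (nth_map false) ?sr // => ri; rewrite ri /=.
  rewrite ltnNge; apply/negP => Fxy.
  have p1 : point (red P) (F x + x).+1 = (x.+1, F x).
    have [/= px py] := (congr1 fst pF, congr1 snd pF).
    by rewrite /point !count_takeS ?sr // px py ri (negbTE ri) addn0 addn1.
  have := point_north_le Pk (k := (F x + x).+1) (y := y).
  by rewrite p1 /= => /(_ Fxy); rewrite ltnNge kyx.
- move=> gi /eqP /= pix yi; rewrite (leq_trans _ yi) //.
  suff -> : h x = (point (green P) i).2 :> nat by [].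
  apply/(north_stepP _ _ Ph); exists i; split.
  + by rewrite (addnC n m) ltn_ord.
  + by rewrite nth_negb_green // -tnth_nth.
  + by rewrite point_negb; congr pair.
- move=> hxy; have imn := north_step_lt Ph x; rewrite (addnC n m) in imn.
  exists (Ordinal imn); rewrite (tnth_nth false) -nth_negb_green // (nth_north_step Ph).
  by rewrite (point_green (point_north_step Ph x)) eqxx.
Qed.

End Shape.

Lemma pmap_inj_uniq (A B : eqType) (f : A -> option B) (l : seq A) x y b :
  uniq (pmap f l) -> x \in l -> y \in l -> f x = Some b -> f y = Some b -> x = y.
Proof.
elim: l => // z l IH ul xl yl fx fy.
have fl t : t \in l -> f t = Some b -> b \in pmap f l.
  by move=> tl ft; rewrite mem_pmap -ft map_f.
move: xl yl ul; rewrite !inE /= => /orP[/eqP xz|xl] /orP[/eqP yz|yl].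
- by rewrite xz yz.
- by rewrite -xz fx /= (fl _ yl fy).
- by rewrite -yz fy /= (fl _ xl fx).
- by case: (f z) => [c /= /andP[_ ul]|/= ul]; exact: IH.
Qed.

Lemma uniq_pmap (A B : eqType) (f : A -> option B) (l : seq A) : uniq l ->
  (forall x y b, f x = Some b -> f y = Some b -> x = y) -> uniq (pmap f l).
Proof.
move=> + inj; elim: l => //= x l IH /andP[xl /IH ul].
case fx: (f x) => [b|] //=; rewrite ul andbT mem_pmap; apply: contra xl.
by case/mapP=> y yl fy; rewrite (inj _ _ _ fx (esym fy)).
Qed.

Section Realize.
Variables (m n : nat).
Hypotheses (m0 : 0 < m) (n0 : 0 < n).
Notation N := (m + n - 1).

(** [P] draws the tree: column [x] carries the label [X x] on its green step,
    row [y] the label [Y y] on its red step.  The ordinal [v] stands for the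
    label [v + 1]. *)
Record realizes (P : lpoly m n) (X : 'I_m -> 'I_N) (Y : 'I_n -> 'I_N)
    (h : 'I_m -> 'I_n) (k : 'I_n -> 'I_m) : Prop := Realizes {
  realizes_red : north_steps m (red P) k;
  realizes_green : north_steps n (map negb (green P)) h;
  realizes_col : forall x, lab P (x, h x) = Some (X x).+1;
  realizes_row : forall y, lab P (k y, y) = Some (Y y).+1;
  realizes_some : forall x y, isSome (lab P (x, y)) = (k y == x) || (h x == y)
}.

Lemma realizes_poly_uniq P P' X Y h k :
  realizes P X Y h k -> realizes P' X Y h k -> P = P'.
Proof.
move=> [Pr Pg Px Py Pl] [Pr' Pg' Px' Py' Pl'].
have er : red P = red P' by apply/val_inj/(north_steps_uniq Pr).
have eg : green P = green P'.
  apply/val_inj/(inj_map negb_inj)/(north_steps_uniq Pg); exact: Pg'.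
have el : lab P = lab P'.
  apply/ffunP => -[x y]; have := Pl x y; have := Pl' x y.
  have [<-|_] := eqVneq (k y) x; first by rewrite Py Py'.
  have [<-|_] := eqVneq (h x) y; first by rewrite Px Px'.
  by case: (lab P _) => //; case: (lab P' _).
case: P P' er eg el {Pr Pg Px Py Pl Pr' Pg' Px' Py' Pl'} => r g l [r' g' l'] /=.
by move=> -> -> ->.
Qed.

Lemma realizes_data_uniq P X Y h k X' Y' h' k' :
  realizes P X Y h k -> realizes P X' Y' h' k' ->
  [/\ X = X', Y = Y', h = h' & k = k'].
Proof.
move=> [Pr Pg Px Py _] [Pr' Pg' Px' Py' _].
have ek : k = k'.
  by apply/funext => y; apply/esym/eqP; rewrite -(red_leftE Pr') (red_leftE Pr).
have eh : h = h'.
  by apply/funext => x; apply/esym/eqP; rewrite -(green_bottomE Pg') (green_bottomE Pg).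
subst k' h'; split=> //; apply/funext => z.
  by apply: val_inj; have := Px z; rewrite Px' => -[].
by apply: val_inj; have := Py z; rewrite Py' => -[].
Qed.

Variables (pi1 pi2 pi3 : {set 'I_N}) (s : 'I_N).
Hypotheses (hpi : ordered_partition pi1 pi2 pi3) (pi2_card : #|pi2| = 1).
Hypothesis hs : s \in pi2.
Notation G := (Gpi pi1 pi2 pi3).

Let pi2E := pi2_sink pi2_card hs.
Let adjE := Gpi_lt hpi pi2_card hs.

Lemma mem_integers_of (A : {set 'I_N}) v : ((val v).+1 \in integers_of A) = (v \in A).
Proof. by rewrite mem_image // => u w [] /val_inj. Qed.

Lemma integers_ofP (A : {set 'I_N}) a :
  reflect (exists2 v : 'I_N, v \in A & a = v.+1) (a \in integers_of A).
Proof. exact: imageP. Qed.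

Lemma labels_inP (P : lpoly m n) (D : pred (cell m n)) a :
  reflect (exists2 c, D c & lab P c = Some a) (a \in labels_in P D).
Proof.
rewrite mem_pmap; apply: (iffP mapP) => [[c]|[c Dc Pc]].
  by rewrite mem_enum => Dc Pc; exists c.
by exists c; rewrite ?mem_enum.
Qed.

Section Colours.
Variables (P : lpoly m n) (h : 'I_m -> 'I_n) (k : 'I_n -> 'I_m).
Hypotheses (Pk : north_steps m (red P) k) (Ph : north_steps n (map negb (green P)) h).
Hypothesis nc : forall (x : 'I_m) (y : 'I_n), x <= k y -> y <= h x ->
  x = 0 :> nat /\ y = 0 :> nat.

Lemma green_parent0 (x : 'I_m) : x = 0 :> nat -> h x = 0 :> nat.
Proof.
by move=> x0; have [|_ ->] := nc (x := x) (y := h x) _ (leqnn _); rewrite ?x0.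
Qed.

Lemma red_parent0 (y : 'I_n) : y = 0 :> nat -> k y = 0 :> nat.
Proof. by move=> y0; have [||-> _] := nc (x := k y) (y := y); rewrite ?y0. Qed.

(** The root cell is the only one with both a red step on its left and a green
    step below it. *)
Lemma both_root x y : (h x == y) && (k y == x) = (x == 0 :> nat) && (y == 0 :> nat).
Proof.
apply/andP/andP => [[/eqP hx /eqP ky]|[/eqP x0 /eqP y0]].
  by have [|| -> ->] := nc (x := x) (y := y); rewrite ?ky ?hx.
have hx := green_parent0 x0; have ky := red_parent0 y0.
by split; apply/eqP/val_inj; rewrite /= ?hx ?ky ?x0 ?y0.
Qed.

Lemma black_cellE x y : black_cell P (x, y) = (x == 0 :> nat) && (y == 0 :> nat).
Proof. by rewrite /black_cell (green_bottomE Ph) (red_leftE Pk) both_root. Qed.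

Lemma green_cellE x y : green_cell P (x, y) = (h x == y) && (0 < x).
Proof.
rewrite /green_cell (green_bottomE Ph) (red_leftE Pk).
case: eqP => //= hx; have := both_root x y; rewrite hx eqxx /= => ->.
rewrite lt0n; case: eqP => //= x0; by rewrite -hx green_parent0.
Qed.

Lemma red_cellE x y : red_cell P (x, y) = (k y == x) && (0 < y).
Proof.
rewrite /red_cell (green_bottomE Ph) (red_leftE Pk).
case: eqP => //= ky; have := both_root x y; rewrite ky eqxx andbT => ->.
rewrite lt0n andbC; case: eqP => //= y0; by rewrite -ky red_parent0.
Qed.

End Colours.

(** In a row the labels decrease from left to right, so siblings in the queue
    of columns are listed by decreasing label. *)
Definition col_ord (v : 'I_N) : nat := rev_ord v.
Definition row_ord (v : 'I_N) : nat := v.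

Notation tree := (queue_tree G s pi1 pi3 col_ord row_ord).

(** The label of column [x > 0] has its parent to its left, in row [h x]: since
    the step of that row lies at [k (h x) < x], the row condition orders the
    two labels.  Columns are treated likewise. *)
Lemma stLPP_tree P : stLPP_of pi1 pi2 pi3 P ->
  exists X Y h k, tree X Y h k /\ realizes P X Y h k.
Proof.
case=> [[[[cr cg above] some _ colP rowP] labs] greens blacks reds].
have [F rF] : exists F : 'I_n -> nat, north_steps m (red P) F.
  by apply: north_steps_ex; rewrite ?size_tuple.
have [H gH] : exists H : 'I_m -> nat, north_steps n (map negb (green P)) H.
  apply: north_steps_ex; first by rewrite size_map size_tuple addnC.
  have := size_tuple (green P); rewrite -(count_predC id) cg count_map addnC.
  by move/addIn.
have [Fm Hn nc'] := strictly_above_bounds rF gH n0 above.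
pose k y := Ordinal (Fm y); pose h x := Ordinal (Hn x).
have Pk : north_steps m (red P) k by [].
have Ph : north_steps n (map negb (green P)) h by [].
have nc (x : 'I_m) (y : 'I_n) : x <= k y -> y <= h x -> x = 0 :> nat /\ y = 0 :> nat.
  exact: nc'.
have lab_val c a : lab P c = Some a -> exists v : 'I_N, a = v.+1.
  move=> Pc; have : a \in iota 1 N.
    by rewrite -(perm_mem labs); apply/labels_inP; exists c.
  rewrite mem_iota => /andP[a0 aN]; have vN : a.-1 < N by lia.
  by exists (Ordinal vN); rewrite /= prednK.
have lab_uniq c c' a : lab P c = Some a -> lab P c' = Some a -> c = c'.
  have lu : uniq (labels_in P predT) by rewrite (perm_uniq labs) iota_uniq.
  by apply: (pmap_inj_uniq lu); rewrite mem_enum.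
have someE x y : isSome (lab P (x, y)) = (k y == x) || (h x == y).
  by rewrite some (red_leftE Pk) (green_bottomE Ph).
have /choice[X XP] (x : 'I_m) : exists v : 'I_N, lab P (x, h x) = Some v.+1.
  have := someE x (h x); rewrite eqxx orbT; case Pc: (lab P _) => [a|] // _.
  by have [v ->] := lab_val _ _ Pc; exists v.
have /choice[Y YP] (y : 'I_n) : exists v : 'I_N, lab P (k y, y) = Some v.+1.
  have := someE (k y) y; rewrite eqxx; case Pc: (lab P _) => [a|] // _.
  by have [v ->] := lab_val _ _ Pc; exists v.
have root v c : lab P c = Some (v : 'I_N).+1 -> black_cell P c -> v = s.
  move=> Pc bc; have : (val v).+1 \in integers_of pi2.
    by rewrite -blacks; apply/labels_inP; exists c.
  by rewrite mem_integers_of pi2E => /set1P.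
have X0 (x : 'I_m) : x = 0 :> nat -> X x = s.
  move=> x0; apply: root (XP x) _.
  by rewrite (black_cellE Pk Ph nc) (green_parent0 nc) x0.
have Y0 (y : 'I_n) : y = 0 :> nat -> Y y = s.
  move=> y0; apply: root (YP y) _.
  by rewrite (black_cellE Pk Ph nc) (red_parent0 nc) y0.
have X1 (x : 'I_m) : 0 < x -> X x \in pi1.
  move=> x0; rewrite -mem_integers_of -greens; apply/labels_inP; exists (x, h x) => //.
  by rewrite (green_cellE Pk Ph nc) eqxx.
have Y1 (y : 'I_n) : 0 < y -> Y y \in pi3.
  move=> y0; rewrite -mem_integers_of -reds; apply/labels_inP; exists (k y, y) => //.
  by rewrite (red_cellE Pk Ph nc) eqxx.
have XS x : X x \in s |: pi1.
  by have [/X0->|/X1 xS] := posnP x; rewrite ?setU11 // inE xS orbT.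
have YS y : Y y \in s |: pi3.
  by have [/Y0->|/Y1 yS] := posnP y; rewrite ?setU11 // inE yS orbT.
exists X, Y, h, k; split=> //; have [_ _ Fmono _] := Pk; have [_ _ Hmono _] := Ph.
split=> //; split=> // [z z' zz'|v|z z0|z z' z0 zz'].
- move: z z' zz' => x x' XX.
  by have := XP x; rewrite XX => Px; have [] := lab_uniq _ _ _ Px (XP x').
- case/setU1P=> [->|v1]; first by exists (Ordinal m0); rewrite X0.
  have /labels_inP[[x y]] : (val v).+1 \in labels_in P (green_cell P).
    by rewrite greens mem_integers_of.
  rewrite (green_cellE Pk Ph nc) => /andP[/eqP<- _]; rewrite XP => -[/val_inj].
  by exists x.
- move: z z0 => x x0.
  rewrite adjE //; have kx : k (h x) < x.
    by rewrite ltnNge; apply/negP => /nc/(_ (leqnn _))[x00]; rewrite x00 in x0.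
  by have := rowP _ _ _ _ _ kx (YP (h x)) (XP x); rewrite ltnS.
- move: z z' z0 zz' => x x' x0 xx'.
  have := Hmono _ _ (ltnW xx'); rewrite leq_eqVlt => /orP[/eqP hxx'|]; last by left.
  right; split; first exact: val_inj.
  have Px := XP x; have hE : h x = h x' by exact: val_inj.
  rewrite hE in Px; have := rowP _ _ _ _ _ xx' Px (XP x').
  by rewrite /col_ord /=; have := ltn_ord (X x); have := ltn_ord (X x'); lia.
- move: z z' zz' => y y' YY.
  by have := YP y; rewrite YY => Py; have [] := lab_uniq _ _ _ Py (YP y').
- case/setU1P=> [->|v1]; first by exists (Ordinal n0); rewrite Y0.
  have /labels_inP[[x y]] : (val v).+1 \in labels_in P (red_cell P).
    by rewrite reds mem_integers_of.
  rewrite (red_cellE Pk Ph nc) => /andP[/eqP<- _]; rewrite YP => -[/val_inj].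
  by exists y.
- move: z z0 => y y0.
  rewrite (adj_sym G) adjE //; have hy : h (k y) < y.
    by rewrite ltnNge; apply/negP => /(nc _ _ (leqnn _))[_ y00]; rewrite y00 in y0.
  by have := colP _ _ _ _ _ hy (XP (k y)) (YP y); rewrite ltnS.
- move: z z' z0 zz' => y y' y0 yy'.
  have := Fmono _ _ (ltnW yy'); rewrite leq_eqVlt => /orP[/eqP kyy'|]; last by left.
  right; split; first exact: val_inj.
  have Py := YP y; have kE : k y = k y' by exact: val_inj.
  by rewrite kE in Py; have := colP _ _ _ _ _ yy' Py (YP y'); rewrite ltnS.
Qed.

Section Tree.
Variables (X : 'I_m -> 'I_N) (Y : 'I_n -> 'I_N) (h : 'I_m -> 'I_n) (k : 'I_n -> 'I_m).
Hypothesis XY : tree X Y h k.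

Let ST := Gpi_bipartite hpi pi2_card hs.
Let TS := bipartite_off_sym ST.
Let YX := queue_tree_sym XY.
Let qX := treeX XY.
Let qY := treeY XY.
Let nc := tree_noncrossing XY.

Lemma queue_mono p q S ord (A : 'I_p -> 'I_N) (B : 'I_q -> 'I_N) (f : 'I_p -> 'I_q) :
  queue G s S ord A B f -> (forall x : 'I_p, x = 0 :> nat -> f x = 0 :> nat) ->
  forall x x' : 'I_p, x <= x' -> f x <= f x'.
Proof.
move=> qA f0 x x'; have [/f0->//|x0] := posnP x.
rewrite leq_eqVlt => /orP[/eqP/val_inj->//|xx'].
by have [/ltnW|[->]] := queue_ord qA x0 xx'.
Qed.

Let h_mono := queue_mono qX (tree_parent0 XY).
Let k_mono := queue_mono qY (tree_parent0 YX).

Lemma tree_col_in x : X x \in s |: pi1.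
Proof.
have [/(queue_root qX)->|/(queue_in qX) xS] := posnP x; first exact: setU11.
by rewrite inE xS orbT.
Qed.

Lemma tree_row_in y : Y y \in s |: pi3.
Proof.
have [/(queue_root qY)->|/(queue_in qY) yS] := posnP y; first exact: setU11.
by rewrite inE yS orbT.
Qed.

Lemma tree_col_parent (x : 'I_m) : 0 < x -> k (h x) < x.
Proof.
by move=> x0; rewrite ltnNge; apply/negP => /nc/(_ (leqnn _))[x00]; rewrite x00 in x0.
Qed.

Lemma tree_col_lt (x : 'I_m) : 0 < x -> X x < Y (h x).
Proof.
by move=> x0; rewrite -adjE ?tree_col_in ?tree_row_in //; exact: queue_adj qX x x0.
Qed.

Lemma tree_row_lt (y : 'I_n) : 0 < y -> X (k y) < Y y.
Proof.
move=> y0; rewrite -adjE ?tree_col_in ?tree_row_in // (adj_sym G).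
exact: queue_adj qY y y0.
Qed.

(** Rows take precedence over columns in the labelling; the two prescriptions
    overlap at the root cell only, where they agree. *)
Lemma tree_poly : exists P, realizes P X Y h k.
Proof.
pose r := mkseq (fun i => [exists y, k y + y == i]) (m + n).
pose g' := mkseq (fun i => [exists x, h x + x == i]) (n + m).
have sr : size r == m + n by rewrite size_mkseq.
have sg : size (map negb g') == m + n by rewrite size_map size_mkseq addnC.
exists (LPoly (Tuple sr) (Tuple sg)
  [ffun c => if k c.2 == c.1 then Some (Y c.2).+1
             else if h c.1 == c.2 then Some (X c.1).+1 else None]).
split=> /= [||x|y|x y].
- by apply: north_steps_mk => // y; exact/ltnW/ltn_ord.
- rewrite (mapK negbK); apply: north_steps_mk => // x; exact/ltnW/ltn_ord.
- rewrite ffunE /= eqxx; case: eqP => // kx.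
  have [|/tree_col_parent] := posnP x; last by rewrite kx ltnn.
  move=> x0; rewrite (queue_root qX) // (queue_root qY) //; exact: tree_parent0 XY _ x0.
- by rewrite ffunE /= eqxx.
- by rewrite ffunE /=; case: eqP => // _; case: eqP.
Qed.

Variable P : lpoly m n.
Hypothesis R : realizes P X Y h k.

Let Pk := realizes_red R.
Let Ph := realizes_green R.

Lemma lab_cases x y a : lab P (x, y) = Some a ->
  (k y = x /\ a = (Y y).+1) \/ [/\ h x = y, 0 < x & a = (X x).+1].
Proof.
move=> Pxy; have := realizes_some R x y; rewrite Pxy /= => /esym.
have [kx _|kx /= /eqP hx] := eqVneq (k y) x.
  by left; split=> //; move: Pxy; rewrite -kx (realizes_row R) => -[].
right; split=> //; last by move: Pxy; rewrite -hx (realizes_col R) => -[].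
have [x0|//] := posnP x; case/eqP: kx; rewrite -hx; apply: val_inj.
by rewrite /= x0; apply/(tree_parent0 YX)/(tree_parent0 XY).
Qed.

Lemma tree_stLPP : stLPP_of pi1 pi2 pi3 P.
Proof.
have mem_lab v : exists c, lab P c = Some (v : 'I_N).+1.
  have [->|vs] := eqVneq v s.
    by exists (Ordinal m0, h (Ordinal m0)); rewrite (realizes_col R) (queue_root qX).
  have [[x _ <-]|[y _ <-]] := tree_vertex ST XY vs.
    by exists (x, h x); exact: realizes_col R x.
  by exists (k y, y); exact: realizes_row R y.
have lab_inj c c' a : lab P c = Some a -> lab P c' = Some a -> c = c'.
  case: c c' => x y [x' y'] /lab_cases[[kx ->]|[hx x0 ->]];
    case/lab_cases=> [[kx' []]|[hx' x0' []]].
  - by move/val_inj/(queue_inj qY) => yy'; rewrite -kx -kx' yy'.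
  - by move/val_inj => YX'; have := queue_neq ST XY y x0'; rewrite YX' eqxx.
  - by move/val_inj => XY'; have := queue_neq ST XY y' x0; rewrite XY' eqxx.
  - by move/val_inj/(queue_inj qX) => xx'; rewrite -hx -hx' xx'.
have lab_pos c a : lab P c = Some a -> exists v : 'I_N, a = v.+1.
  by case: c => x y /lab_cases[[_ ->]|[_ _ ->]]; [exists (Y y)|exists (X x)].
split; [split; first split; first split| | |].
- by case: (count_red Pk).
- by case: (count_green Ph).
- exact: noncrossing_strictly_above Pk Ph nc.
- by case=> x y; rewrite (realizes_some R) (red_leftE Pk) (green_bottomE Ph).
- by move=> c a /lab_pos[v ->].
- move=> x y1 y2 a b lt_y /lab_cases[[k1 ->]|[h1 x0 ->]];
    case/lab_cases=> [[k2 ->]|[h2 x0' ->]].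
  + have [y0|y0] := posnP y1; last first.
      by have := queue_ord qY y0 lt_y; rewrite k1 k2 ltnn => -[//|[_]].
    have -> : Y y1 = X (k y2).
      rewrite k2 -k1 (queue_root qY) // (queue_root qX) //.
      exact: tree_parent0 YX _ y0.
    by rewrite ltnS tree_row_lt // (leq_trans _ lt_y).
  + have [||x00 _] := nc (x := x) (y := y1); rewrite ?k1 ?h2 // 1?ltnW //.
    by rewrite x00 in x0'.
  + by rewrite ltnS -k2 tree_row_lt // (leq_trans _ lt_y).
  + by move: lt_y; rewrite -h1 h2 ltnn.
- move=> x1 x2 y a b lt_x /lab_cases[[k1 ->]|[h1 x0 ->]];
    case/lab_cases=> [[k2 ->]|[h2 x0' ->]].
  + by move: lt_x; rewrite -k1 k2 ltnn.
  + by rewrite ltnS -h2 tree_col_lt.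
  + have [||x00 _] := nc (x := x1) (y := y); rewrite ?h1 ?k2 // 1?ltnW //.
    by rewrite x00 in x0.
  + have := queue_ord qX x0 lt_x; rewrite h1 h2 ltnn => -[//|[_]].
    by rewrite /col_ord /=; lia.
- apply: uniq_perm; [|exact: iota_uniq|] => [|a].
    by apply: uniq_pmap lab_inj; exact: enum_uniq.
  rewrite mem_iota; apply/labels_inP/idP => [[c _ /lab_pos[v ->]]|a1].
    by have := ltn_ord v; lia.
  have aN : a.-1 < N by lia.
  have [c Pc] := mem_lab (Ordinal aN); exists c => //.
  by rewrite Pc /= prednK //; lia.
- move=> a; apply/labels_inP/integers_ofP => [[[x y]]|[v v1 ->]].
    rewrite (green_cellE Pk Ph nc) => /andP[/eqP<- x0].
    rewrite (realizes_col R) => -[<-].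
    by exists (X x); first exact: queue_in qX x x0.
  have [|x Xv] := queue_onto qX (v := v); first by rewrite inE v1 orbT.
  exists (x, h x); last by rewrite (realizes_col R) Xv.
  rewrite (green_cellE Pk Ph nc) eqxx lt0n -(queue_eq_root ST XY) Xv /=.
  by apply: contraTneq v1 => ->; exact: off_rootS ST.
- move=> a; apply/labels_inP/integers_ofP => [[[x y]]|[v]].
    rewrite (black_cellE Pk Ph nc) => /andP[/eqP x0 /eqP y0].
    have -> : y = h x by apply: val_inj; rewrite /= y0 (tree_parent0 XY).
    by rewrite (realizes_col R) (queue_root qX) // => -[<-]; exists s.
  rewrite pi2E => /set1P-> ->; exists (Ordinal m0, h (Ordinal m0)).
    by rewrite (black_cellE Pk Ph nc) (tree_parent0 XY).
  by rewrite (realizes_col R) (queue_root qX).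
- move=> a; apply/labels_inP/integers_ofP => [[[x y]]|[v v3 ->]].
    rewrite (red_cellE Pk Ph nc) => /andP[/eqP<- y0].
    rewrite (realizes_row R) => -[<-].
    by exists (Y y); first exact: queue_in qY y y0.
  have [|y Yv] := queue_onto qY (v := v); first by rewrite inE v3 orbT.
  exists (k y, y); last by rewrite (realizes_row R) Yv.
  rewrite (red_cellE Pk Ph nc) eqxx lt0n -(queue_eq_root TS YX) Yv /=.
  by apply: contraTneq v3 => ->; exact: off_rootT ST.
Qed.

(** In an unlabelled square between the paths, the label to the left is that of
    the row and the label below is that of the column; comparing them is
    testing adjacency. *)
Lemma tree_area : area P =
  #|[pred c : 'I_m * 'I_n | [&& k c.2 < c.1, h c.1 < c.2 & G (X c.1) (Y c.2)]]|.
Proof.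
apply: eq_card => -[x y]; rewrite !inE /= (betweenE Pk Ph).
have -> : (lab P (x, y) == None) = (k y != x) && (h x != y).
  have := realizes_some R x y; rewrite -negb_or => <-; by case: (lab P _).
rewrite (ltn_neqAle (k y)) (ltn_neqAle (h x)) -!(inj_eq val_inj) /=.
case kx: (nat_of_ord (k y) == x); rewrite ?andbF //=.
case hy: (nat_of_ord (h x) == y); rewrite ?andbF //=.
case kxle: (k y <= x); rewrite //=; case hyle: (h x <= y); rewrite //=.
have ltk : k y < x by rewrite ltn_neqAle kx.
have lth : h x < y by rewrite ltn_neqAle hy.
have /= -> := adjE (tree_col_in x) (tree_row_in y).
apply/existsP/idP => [[x' /existsP[y' /= /and3P[x'x y'y]]]|XYlt]; last first.
  exists (k y); apply/existsP; exists (h x).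
  by rewrite /= ltk lth (realizes_row R) (realizes_col R) ltnS.
case Pa: (lab P (x', y)) => [a|] //; case Pb: (lab P (x, y')) => [b|] //.
case: (lab_cases Pa) => [[_ ->]|[hx' _ _]]; last first.
  by have := h_mono (ltnW x'x); rewrite hx' leqNgt lth.
case: (lab_cases Pb) => [[ky' _]|[_ _ ->]]; last by rewrite ltnS.
by have := k_mono (ltnW y'y); rewrite ky' leqNgt ltk.
Qed.

End Tree.

End Realize.

(** * The bijection *)

Theorem proposition7p11 (m n : nat) (hm : 1 <= m) (hn : 1 <= n)
    (pi1 pi2 pi3 : {set 'I_(m + n - 1)})
    (hpi : ordered_partition pi1 pi2 pi3)
    (h1 : #|pi1| = m - 1) (h2 : #|pi2| = 1) (h3 : #|pi3| = n - 1)
    (s : 'I_(m + n - 1)) (hs : s \in pi2) :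
  exists alpha : lpoly m n -> config 'I_(m + n - 1),
    set_bij (stLPP_of pi1 pi2 pi3) (Rec (Gpi pi1 pi2 pi3) s) alpha
    /\ forall P : lpoly m n, stLPP_of pi1 pi2 pi3 P ->
         Posz (area P) = level (Gpi pi1 pi2 pi3) (alpha P).
Proof.
have ST := Gpi_bipartite hpi h2 hs; have toTree := stLPP_tree hm hn hpi h2 hs.
pose G := Gpi pi1 pi2 pi3.
have /choice[alpha alphaE] (P : lpoly m n) : exists c : config 'I_(m + n - 1),
    stLPP_of pi1 pi2 pi3 P -> exists X Y h k,
    [/\ queue_tree G s pi1 pi3 (@col_ord m n) (@row_ord m n) X Y h k,
        realizes P X Y h k & c = tree_config G X Y h k].
  have [/toTree[X [Y [h [k [XY R]]]]]|nP] := pselect (stLPP_of pi1 pi2 pi3 P).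
    by exists (tree_config G X Y h k) => _; exists X, Y, h, k.
  by exists [ffun=> 0] => /nP.
have ordX_inj : injective (@col_ord m n) by move=> u v /val_inj/rev_ord_inj.
have ordY_inj : injective (@row_ord m n) by move=> u v /val_inj.
exists alpha; split; last first.
  move=> P /alphaE[X [Y [h [k [XY R ->]]]]].
  by rewrite (level_tree_config hm hn ST XY) (tree_area hpi h2 hs XY R).
split.
- by move=> P /alphaE[X [Y [h [k [XY _ ->]]]]]; exact: tree_config_Rec hm hn ST XY.
- move=> P P' /set_mem/alphaE[X [Y [h [k [XY R ->]]]]].
  move=> /set_mem/alphaE[X' [Y' [h' [k' [XY' R' ->]]]]] cc'.
  have [eX eY eh ek] := queue_tree_inj ST XY XY' cc' hm hn; subst X' Y' h' k'.
  exact: realizes_poly_uniq R R'.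
move=> c rc; have [stc cs _] := rc.
have cdeg v : v != s -> c v < deg G v by move/stc; rewrite /unstable -ltnNge.
have conn v : connect G s v.
  have [->|vs] := eqVneq v s; first exact: connect0.
  by apply: (Gpi_connect hpi h2 hs vs); exact: leq_trans (cdeg _ vs).
have crit (U : {set 'I_(m + n - 1)}) : s \notin U -> U != set0 ->
    exists2 v, v \in U & nbrs_in G U v <= c v.
  by move=> _; exact: Rec_criterion conn rc.
have needs : need G c s = 0 by rewrite /need cs subnn.
have need_gt0 v : v != s -> 0 < need G c v by move/cdeg; rewrite /need subn_gt0.
have [X [Y [h [k [XY cE]]]]] : exists (X : 'I_m -> _) (Y : 'I_n -> _) h k,
    queue_tree G s pi1 pi3 (@col_ord m n) (@row_ord m n) X Y h k /\
    tree_config G X Y h k = c.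
  have card1 : #|pi1| = m.-1 by rewrite h1 subn1.
  have card3 : #|pi3| = n.-1 by rewrite h3 subn1.
  apply: (queue_tree_exists needs need_gt0 ST card1 card3 hm hn ordX_inj ordY_inj
    _ _ cs crit) => v; exact: ltn_ord.
have [P R] := tree_poly XY.
have PT := tree_stLPP hm hn hpi h2 hs XY R.
exists P => //; have [X' [Y' [h' [k' [_ R' ->]]]]] := alphaE P PT.
by have [-> -> -> ->] := realizes_data_uniq R' R.
Qed.
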